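(* There exists an absolute constant $C_1>0$ such that the following holds. Let $n,p,M\ge1$, $\sigma>0$, $\mu\in\mathbb{R}^n$, let $y=\mu+\varepsilon$ with $\varepsilon\sim N(0,\sigma^2I_{n\times n})$, and let $X\in\mathbb{R}^{n\times p}$ be a deterministic matrix. Let $K$ be a (deterministic) positive definite matrix of size $p\times p$ and let $\lambda_1,\dots,\lambda_M\ge0$ be distinct tuning parameters (if some $\lambda_j=0$, assume that $X^TX$ is invertible). Let $\hat\theta$ be a minimizer $$\hat\theta\in\mathop{\rm arg\,min}_{\theta\in\Lambda_M}\Big(\frac12\Big\|\sum_{j=1}^M\theta_jX\hat w(K,\lambda_j)-y\Big\|^2+2\sigma^2\sum_{j=1}^M\theta_j\,\mathrm{df}_j+\frac12\sum_{j=1}^M\theta_j\|X\hat w(K,\lambda_j)-y\|^2\Big),$$ where $\mathrm{df}_j=\mathrm{trace}[X(X^TX+\lambda_jK)^{-1}X^T]$. Then the vector $\tilde w=\sum_{j=1}^M\hat\theta_j\hat w(K,\lambda_j)\in\mathbb{R}^p$ satisfies $$\mathbb{E}\big[\|X\tilde w-\mu\|^2\big]-\min_{j=1,\dots,M}\mathbb{E}\big[\|X\hat w(K,\lambda_j)-\mu\|^2\big]\le C_1\sigma^2.$$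
   Context: $\|\cdot\|$ is the Euclidean norm. Positive definite matrices are symmetric. ''Absolute constant'' means a number not depending on any other quantity. $\Lambda_M=\{\theta\in\mathbb{R}^M:\theta_j\ge0,\ \sum_{j=1}^M\theta_j=1\}$. The Tikhonov regularized estimator with penalty matrix $K$ and tuning parameter $\lambda$ is $\hat w(K,\lambda)=\mathop{\rm arg\,min}_{w\in\mathbb{R}^p}\big(\|Xw-y\|^2+\lambda w^TKw\big)=(X^TX+\lambda K)^{-1}X^Ty$. *)

(* Defs.v *)
From HB Require Import structures.
From mathcomp Require Import all_boot all_order all_algebra.
From mathcomp Require Import ring lra.
From mathcomp Require Import all_classical all_reals all_analysis.

Set Implicit Arguments.
Unset Strict Implicit.
Unset Printing Implicit Defensive.

Import Order.TTheory GRing.Theory Num.Theory.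

Local Open Scope classical_set_scope.
Local Open Scope ring_scope.

(* The norm that the library puts on matrices is the sup norm. *)
Definition l2norm (R : realType) (m : nat) (v : 'cV[R]_m) : R :=
  Num.sqrt (\sum_(i < m) v i 0 ^+ 2).

Definition qform (R : realType) (m : nat) (A : 'M[R]_m) (v : 'cV[R]_m) : R :=
  (v^T *m A *m v) 0 0.

Definition posdefmx (R : realType) (m : nat) (A : 'M[R]_m) : Prop :=
  A^T = A /\ forall v : 'cV[R]_m, v != 0 -> 0 < qform A v.

Definition is_argmin (R : realType) (U : Type) (D : set U) (f : U -> R)
    (x : U) : Prop :=
  D x /\ forall z, D z -> f x <= f z.

Definition simplex (R : realType) (M : nat) : set 'cV[R]_M :=
  [set theta | (forall j, 0 <= theta j 0) /\ \sum_(j < M) theta j 0 = 1].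

(* The product rule over the whole family covers every subfamily: take B i to
   be the full set for the other indices. *)
Definition mutually_independent (R : realType) (d : measure_display)
    (T : measurableType d) (P : probability T R) (I : finType)
    (Z : I -> {RV P >-> R}) : Prop :=
  forall B : I -> set R, (forall i, measurable (B i)) ->
    P (\bigcap_(i in [set: I]) (Z i @^-1` B i)) =
    (\prod_(i : I) P (Z i @^-1` B i))%E.

(* The random vector with coordinates eps i has law N(0, sigma^2 I_n).
   The second argument of normal_prob is the standard deviation. *)
Definition gaussian_noise (R : realType) (d : measure_display)
    (T : measurableType d) (P : probability T R) (n : nat) (sigma : R)
    (eps : 'I_n -> {RV P >-> R}) : Prop :=
  mutually_independent eps /\
  forall (i : 'I_n) (B : set R), measurable B ->
    distribution P (eps i) B = normal_prob 0 sigma B.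

Definition tikhonov_obj (R : realType) (n p : nat) (X : 'M[R]_(n, p))
    (K : 'M[R]_p) (lam : R) (y : 'cV[R]_n) (w : 'cV[R]_p) : R :=
  l2norm (X *m w - y) ^+ 2 + lam * qform K w.

Definition tikhonov (R : realType) (n p : nat) (X : 'M[R]_(n, p))
    (K : 'M[R]_p) (lam : R) (y : 'cV[R]_n) : 'cV[R]_p :=
  invmx (X^T *m X + lam *: K) *m X^T *m y.

Definition tikhonov_df (R : realType) (n p : nat) (X : 'M[R]_(n, p))
    (K : 'M[R]_p) (lam : R) : R :=
  \tr (X *m invmx (X^T *m X + lam *: K) *m X^T).

Definition aggregate (R : realType) (n p M : nat) (X : 'M[R]_(n, p))
    (K : 'M[R]_p) (lam : 'I_M -> R) (y : 'cV[R]_n) (theta : 'cV[R]_M) :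
    'cV[R]_p :=
  \sum_(j < M) theta j 0 *: tikhonov X K (lam j) y.

Definition Q_obj (R : realType) (n p M : nat) (X : 'M[R]_(n, p))
    (K : 'M[R]_p) (lam : 'I_M -> R) (sigma : R) (y : 'cV[R]_n)
    (theta : 'cV[R]_M) : R :=
  2^-1 * l2norm (\sum_(j < M) theta j 0 *: (X *m tikhonov X K (lam j) y) - y) ^+ 2
  + 2 * sigma ^+ 2 * (\sum_(j < M) theta j 0 * tikhonov_df X K (lam j))
  + 2^-1 * (\sum_(j < M)
              theta j 0 * l2norm (X *m tikhonov X K (lam j) y - y) ^+ 2).

Lemma l2norm_sqr (R : realType) (m : nat) (v : 'cV[R]_m) :
  l2norm v ^+ 2 = (v^T *m v) 0 0.
Proof.
rewrite /l2norm sqr_sqrtr; last by apply: sumr_ge0 => i _; exact: sqr_ge0.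
by rewrite !mxE; apply: eq_bigr => i _; rewrite mxE expr2.
Qed.

Lemma l2norm_sqr_eq0 (R : realType) (m : nat) (v : 'cV[R]_m) :
  l2norm v ^+ 2 = 0 -> v = 0.
Proof.
rewrite /l2norm sqr_sqrtr; last by apply: sumr_ge0 => i _; exact: sqr_ge0.
move=> /eqP; rewrite psumr_eq0; last by move=> i _; exact: sqr_ge0.
move=> /allP h; apply/colP => i; rewrite mxE.
by apply/eqP; rewrite -sqrf_eq0; exact: (h i (mem_index_enum i)).
Qed.

Lemma qformD (R : realType) (m : nat) (A : 'M[R]_m) (u v : 'cV[R]_m) :
  A^T = A ->
  qform A (u + v) = qform A u + 2 * (v^T *m (A *m u)) 0 0 + qform A v.
Proof.
move=> Asym; rewrite /qform.
have -> : (u + v)^T *m A *m (u + v)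
    = u^T *m A *m u + u^T *m A *m v + (v^T *m (A *m u) + v^T *m A *m v).
  by rewrite [(u + v)^T]linearD/= !mulmxDl !mulmxDr mulmxA.
have e : (u^T *m A *m v) 0 0 = (v^T *m (A *m u)) 0 0.
  transitivity ((u^T *m A *m v)^T 0 0); first by rewrite [RHS]mxE.
  by rewrite !trmx_mul trmxK Asym.
move: e (u^T *m A *m u) (v^T *m A *m v); move: (v^T *m _).
by move=> b; move: (_ *m v) => a e c f; rewrite !mxE e; lra.
Qed.

Lemma tikhonov_posdef (R : realType) (n p : nat) (X : 'M[R]_(n, p))
    (K : 'M[R]_p) (lam : R) :
  posdefmx K -> 0 <= lam -> (lam = 0 -> X^T *m X \in unitmx) ->
  posdefmx (X^T *m X + lam *: K).
Proof.
move=> [Ksym Kpos] lam0 hX; split.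
  by rewrite linearD/= linearZ/= trmx_mul trmxK Ksym.
move=> v v0.
have -> : qform (X^T *m X + lam *: K) v
    = l2norm (X *m v) ^+ 2 + lam * qform K v.
  by rewrite l2norm_sqr /qform trmx_mul mulmxDr mulmxDl -scalemxAr -scalemxAl
             !mulmxA !mxE.
have [lam_eq0|lam_neq0] := eqVneq lam 0; last first.
  by rewrite ltr_wpDl ?sqr_ge0// mulr_gt0 ?Kpos// lt0r lam_neq0.
rewrite lam_eq0 mul0r addr0 lt0r sqr_ge0 andbT.
apply: contra v0 => /eqP/l2norm_sqr_eq0 Xv0.
by rewrite -(mulKmx (hX lam_eq0) v) -mulmxA Xv0 !mulmx0.
Qed.

Lemma posdefmx_unit (R : realType) (m : nat) (A : 'M[R]_m) :
  posdefmx A -> A \in unitmx.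
Proof.
move=> [_ Apos]; rewrite -row_free_unit -kermx_eq0.
apply/eqP/row_matrixP => i; rewrite row0; apply/eqP.
apply/negPn/negP => k0; set v := row i (kermx A) in k0.
have vA : v *m A = 0 by apply/sub_kermxP; exact: row_sub.
have := Apos v^T; rewrite /qform trmxK vA mul0mx mxE ltxx => h.
by suff /h : v^T != 0 by []; rewrite trmx_eq0.
Qed.

(* The closed form is the unique minimizer of the penalized least squares. *)
Lemma tikhonov_argmin (R : realType) (n p : nat) (X : 'M[R]_(n, p))
    (K : 'M[R]_p) (lam : R) (y : 'cV[R]_n) (w : 'cV[R]_p) :
  posdefmx K -> 0 <= lam -> (lam = 0 -> X^T *m X \in unitmx) ->
  is_argmin [set: 'cV[R]_p] (tikhonov_obj X K lam y) w <->
  w = tikhonov X K lam y.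
Proof.
move=> Kpd lam0 hX.
have Apd := tikhonov_posdef Kpd lam0 hX.
set A := X^T *m X + lam *: K in Apd.
have AU := posdefmx_unit Apd.
set u := tikhonov X K lam y.
have objE z : tikhonov_obj X K lam y z =
    qform A z - 2 * (z^T *m (X^T *m y)) 0 0 + (y^T *m y) 0 0.
  rewrite /tikhonov_obj l2norm_sqr.
  have -> : (X *m z - y)^T *m (X *m z - y) = z^T *m (X^T *m X) *m z
      - z^T *m (X^T *m y) - (z^T *m (X^T *m y))^T + y^T *m y.
    rewrite [(X *m z - y)^T]linearB/= mulmxBl !mulmxBr !trmx_mul !trmxK.
    by rewrite !mulmxA opprB !addrA addrAC.
  have -> : qform A z = (z^T *m (X^T *m X) *m z) 0 0 + lam * qform K z.
    by rewrite /qform /A mulmxDr mulmxDl -scalemxAr -scalemxAl !mxE.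
  set a := z^T *m (X^T *m X) *m z; set b := z^T *m (X^T *m y).
  set c := y^T *m y.
  by rewrite !mxE; lra.
have objD v : tikhonov_obj X K lam y (u + v)
    = tikhonov_obj X K lam y u + qform A v.
  rewrite !objE qformD; last by case: Apd.
  have -> : A *m u = X^T *m y by rewrite /u /tikhonov -!mulmxA mulKVmx.
  rewrite [(u + v)^T]linearD/= mulmxDl.
  by move: (u^T *m _) (v^T *m _) => a b; rewrite !mxE; lra.
have q0 v : 0 <= qform A v.
  have [->|/(proj2 Apd)/ltW//] := eqVneq v 0.
  by rewrite /qform mulmx0 mxE.
split=> [[_ wmin]|->]; last first.
  by split=> // z _; rewrite -(subrK u z) [z - u + u]addrC objD lerDl.
apply/eqP/negPn/negP => wu.
have := wmin u I; rewrite -[w](subrK u) [w - u + u]addrC objD leNgt ltrDl.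
by rewrite (proj2 Apd)// subr_eq0.
Qed.

(* Main.v *)
Require Import Defs.
From HB Require Import structures.
From mathcomp Require Import all_boot all_order all_algebra.
From mathcomp Require Import ring lra zify.
From mathcomp Require Import all_classical all_reals all_analysis.
From mathcomp Require Import measurable_realfun.

(* Let [A_j] be the smoother with parameter [lam j], [B_j = A_j - A_j0] for an
   oracle [j0], and let [F_j] be the mean of [|B_j y|^2].  First-order optimality
   of [theta] at the vertex [j0] bounds the excess loss by
   [max_j (z_j - F_j / 2)], where [z_j] is a centered quadratic polynomial
   ("chaos") in the noise.  On each side of [lam j0] the smoothers are ordered
   and [F] is monotone, and [E (z_j - z_k)^4 <= C sigma^4 (F_j - F_k)^2].  Since
   the exponent of [F_j - F_k] exceeds one, bisection bounds the maximum of
   [(z_j - z_k)^4] over a block by a weighted sum of such increments without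
   losing a logarithm in [M]; peeling over dyadic values of [F] then
   absorbs the maximum into [F_j / 2] up to [C sigma^2].

   No spectral decomposition is used: the order and commutation properties of
   the smoothers come from resolvent identities, and the fourth moment of a
   chaos is bounded by adding the noise coordinates one at a time, as for a
   martingale. *)

Set Implicit Arguments.
Unset Strict Implicit.
Unset Printing Implicit Defensive.

Import Order.TTheory GRing.Theory Num.Theory.
Import numFieldNormedType.Exports.

Local Open Scope classical_set_scope.
Local Open Scope ring_scope.

(** * Chaining along a monotone sequence *)

(** The weights of the increments are chosen from [F] alone, before the noise is seen. The majorant
    of all the [z_j] is therefore a polynomial in the noise, integrable without further argument,
    and neither a maximum of random variables nor a measurable choice of [theta] ever has to be
    integrated. The power four is the smallest even one that works: second moments of [z_j - z_k]
    are only linear in [F_j - F_k], the two halves of a bisected block then cost as much as the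
    block itself, and each level adds to the bound. The two sides of the oracle are kept apart
    because the increments are compared with [F] through [|B_k v|^2 - |B_j v|^2 >= |(A_k - A_j)
    v|^2], whose cross term has the right sign only when the parameters move away from [lam j0] in
    one direction. The offset [tau] in the peeling is taken to be [sigma^2]: the increments
    contribute [sigma^4] and the sum over the shells contributes [1 / tau], so both the offset and
    the chaining cost are of order [sigma^2]. *)

Lemma exprD4_le (R : realFieldType) (x y : R) :
  (x + y) ^+ 4 <= 3 / 2 * x ^+ 4 + 729 * y ^+ 4.
Proof.
have sqD (a b : R) : (a + b) ^+ 2 <= 9 / 8 * a ^+ 2 + 9 * b ^+ 2.
  by have := sqr_ge0 (a - 8 * b); lra.
have xy : ((x + y) ^+ 2) ^+ 2 <= (9 / 8 * x ^+ 2 + 9 * y ^+ 2) ^+ 2.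
  rewrite ler_sqr ?sqD// nnegrE ?sqr_ge0//.
  by have := sqr_ge0 x; have := sqr_ge0 y; lra.
(* The second use of [sqD] gives the factors [(9/8)^3 = 729/512 < 3/2] and [9 * 9^2 = 729]. *)
have := sqD (9 / 8 * x ^+ 2) (9 * y ^+ 2).
have := exprn_even_ge0 x (isT : ~~ odd 4); move: xy; rewrite -!exprM/=.
lra.
Qed.

Definition admissible (R : numDomainType) (a b : nat)
    (s : seq (R * (nat * nat))) :=
  all (fun q => [&& (0 <= q.1)%R, a <= q.2.1, q.2.1 <= q.2.2 & q.2.2 <= b]%N) s.

(** The same list is evaluated twice: with [k = 4] at [z], as a pointwise majorant, and with [k = 2]
    at [F], as a bound on the expectation of that majorant. *)
Definition incr_sum (R : pzRingType) (k : nat) (s : seq (R * (nat * nat)))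
    (z : nat -> R) : R :=
  \sum_(q <- s) q.1 * (z q.2.2 - z q.2.1) ^+ k.

Lemma incr_sum_cat (R : pzRingType) k s1 s2 (z : nat -> R) :
  incr_sum k (s1 ++ s2) z = incr_sum k s1 z + incr_sum k s2 z.
Proof. exact: big_cat. Qed.

Lemma incr_sum_scale (R : pzRingType) k c s (z : nat -> R) :
  incr_sum k [seq (c * q.1, q.2) | q <- s] z = c * incr_sum k s z.
Proof.
by rewrite /incr_sum big_map mulr_sumr; apply: eq_bigr => q _; rewrite mulrA.
Qed.

Lemma incr_sum_seq1 (R : pzRingType) k c i j (z : nat -> R) :
  incr_sum k [:: (c, (i, j))] z = c * (z j - z i) ^+ k.
Proof. exact: big_seq1. Qed.

Lemma incr_sum_ge0 (R : realDomainType) k a b s (z : nat -> R) :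
  ~~ odd k -> admissible a b s -> 0 <= incr_sum k s z.
Proof.
move=> k_even /allP sP; rewrite /incr_sum big_seq; apply: sumr_ge0 => q /sP.
by case/andP => q0 _; rewrite mulr_ge0// exprn_even_ge0.
Qed.

Lemma admissible_scale (R : numDomainType) (c : R) a b s :
  0 <= c -> admissible a b s ->
  admissible a b [seq (c * q.1, q.2) | q <- s].
Proof.
move=> c0 /allP sP; apply/allP => _ /mapP[q /sP q_ok ->] /=; case/andP: q_ok => q0 qab.
by rewrite mulr_ge0.
Qed.

Lemma admissible_widen (R : numDomainType) a b a' b' (s : seq (R * (nat * nat))) :
  (a' <= a)%N -> (b <= b')%N -> admissible a b s -> admissible a' b' s.
Proof.
move=> aa bb /allP sP; apply/allP => q /sP /and4P[-> h1 -> h3] /=.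
by rewrite (leq_trans aa h1) (leq_trans h3 bb).
Qed.

(* Bisection at the first index where [F] has made half of its total increase;
   the splitting constants satisfy [2 * (3 / 2) * (1 / 2) ^ 2 < 1]. *)
Lemma chaining_block (R : realFieldType) (F : nat -> R) (a b : nat) :
  (a <= b)%N ->
  (forall i j, (a <= i <= j)%N -> (j <= b)%N -> F i <= F j) ->
  exists s, [/\ admissible a b s,
    forall z i, (a <= i <= b)%N -> (z i - z a) ^+ 4 <= incr_sum 4 s z &
    incr_sum 2 s F <= 2916 * (F b - F a) ^+ 2].
Proof.
have [m] := ubnP (b - a); elim: m a b => // m IH a b bam ab Fnd.
have [->|aNb] := eqVneq a b.
  exists [::]; split => // [z i|]; rewrite /incr_sum big_nil.
    by move=> /anti_leq ->; rewrite subrr expr0n.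
  by rewrite subrr expr0n mulr0.
have ltab : (a < b)%N by rewrite ltn_neqAle aNb.
have Uge0 : 0 <= F b - F a by rewrite subr_ge0 Fnd ?leqnn// ab.
set U := F b - F a in Uge0 *.
have exh : exists h, (a < h <= b)%N && (U / 2 <= F h - F a).
  by exists b; rewrite ltab leqnn /=; rewrite -/U; lra.
case: (ex_minnP exh) => h /andP[/andP[ah hb] Fh hmin].
(* The left block ends at [h.-1] and not at [h], since [F] may jump at [h] by far more than half of
   [U]. *)
have {}hmin : F h.-1 - F a <= U / 2.
  have [->|ha] := eqVneq h.-1 a; first by rewrite subrr; lra.
  rewrite leNgt; apply/negP => /ltW lt.
  have := hmin h.-1; rewrite lt andbT.
  have -> : (a < h.-1 <= b)%N by lia.
  by move=> /(_ isT); lia.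
have [|||s1 [s1P s1z s1F]] := IH a h.-1.
- by lia.
- by lia.
- by move=> i j ij jh; apply: Fnd => //; lia.
have [|//||s2 [s2P s2z s2F]] := IH h b.
- by clear -bam ah hb; lia.
- by move=> i j /andP[hi ij] jb; apply: Fnd => //; rewrite (leq_trans (ltnW ah) hi).
(* The increment from [a] to [h] bridges the jump: right of [h], [exprD4_le] is applied to
   [(z i - z h) + (z h - z a)]. *)
exists ([seq (3 / 2 * q.1, q.2) | q <- s1 ++ s2] ++ [:: (729, (a, h))]); split.
- rewrite /admissible all_cat; apply/andP; split; last first.
    by rewrite /= leqnn hb (ltnW ah) ler0n.
  apply: admissible_scale; first by rewrite divr_ge0.
  rewrite /admissible all_cat; apply/andP; split.
    exact: admissible_widen (leqnn a) (leq_trans (leq_pred h) hb) s1P.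
  exact: admissible_widen (ltnW ah) (leqnn b) s2P.
- move=> z i /andP[ai ib].
  rewrite incr_sum_cat incr_sum_scale incr_sum_cat incr_sum_seq1.
  have s10 : 0 <= incr_sum 4 s1 z by apply: incr_sum_ge0 s1P.
  have s20 : 0 <= incr_sum 4 s2 z by apply: incr_sum_ge0 s2P.
  have := exprn_even_ge0 (z h - z a) (isT : ~~ odd 4).
  have [ih|hi] := ltnP i h.
    have := s1z z i; rewrite ai /= -ltnS (ltn_predK ah) ih => /(_ isT).
    by clear -s10 s20; lra.
  have := s2z z i; rewrite hi ib => /(_ isT).
  have := exprD4_le (z i - z h) (z h - z a); rewrite subrKA.
  by clear -s10 s20; lra.
(* The constant is the fixed point [c = 3/2 * 2 * c/4 + 729], that is [c = 4 * 729 = 2916]. *)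
- rewrite incr_sum_cat incr_sum_scale incr_sum_cat incr_sum_seq1.
  have F1 : (F h.-1 - F a) ^+ 2 <= (U / 2) ^+ 2.
    rewrite ler_sqr ?nnegrE ?subr_ge0 ?divr_ge0//.
    apply: Fnd; last exact: leq_trans (leq_pred h) hb.
    by rewrite leqnn -ltnS (ltn_predK ah).
  have F2 : (F b - F h) ^+ 2 <= (U / 2) ^+ 2.
    rewrite ler_sqr ?nnegrE ?subr_ge0 ?divr_ge0//.
      by clear -Fh; rewrite /U in Fh *; lra.
    by apply: Fnd; rewrite ?leqnn// (ltnW ah).
  have F3 : (F h - F a) ^+ 2 <= U ^+ 2.
    have aF : F a <= F h by apply: Fnd; rewrite ?leqnn ?(ltnW ah).
    rewrite ler_sqr ?nnegrE ?subr_ge0 ?lerD2r// Fnd ?leqnn//.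
    by rewrite (ltnW ah).
  by clear -s1F s2F F1 F2 F3; lra.
Qed.

(* The shell [4 ^ N * tau <= F i + tau < 4 ^ N.+1 * tau] contributes at most
   [2916 * 16 / (4 ^ N * tau)] to the last sum. *)
Lemma chaining_peeled (R : realType) (F : nat -> R) (b : nat) (tau : R) :
  0 < tau -> F 0%N = 0 ->
  (forall i j, (i <= j <= b)%N -> F i <= F j) ->
  exists s, [/\ admissible 0 b s,
    forall z i, z 0%N = 0 -> (i <= b)%N ->
      z i ^+ 4 / (F i + tau) ^+ 3 <= incr_sum 4 s z &
    incr_sum 2 s F <= 2916 * 64 / 3 / tau].
Proof.
move=> tau0 F0 Fnd.
have Fge0 i : (i <= b)%N -> 0 <= F i by move=> ib; rewrite -F0 Fnd ?leq0n.
(* The last factor is a partial geometric sum: adding [16 / 4^k] over [k < N] gives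
   [64/3 * (1 - 4^-N)]. *)
suff shells N : exists s, [/\ admissible 0 b s,
    forall z i, z 0%N = 0 -> (i <= b)%N -> F i + tau < 4 ^+ N * tau ->
      z i ^+ 4 / (F i + tau) ^+ 3 <= incr_sum 4 s z &
    incr_sum 2 s F <= 2916 * 64 / 3 / tau * (1 - (4 ^+ N)^-1)].
  pose N := (Num.bound ((F b + tau) / tau)).
  have NP : F b + tau < 4 ^+ N * tau.
    rewrite -ltr_pdivrMr//.
    apply: (@lt_trans _ _ N%:R).
      by rewrite archi_boundP// divr_ge0 ?addr_ge0 ?Fge0 ?(ltW tau0).
    by rewrite -natrX ltr_nat ltn_expl.
  have [s [sP sz sF]] := shells N; exists s; split=> //.
    move=> z i z0 ib; apply: sz => //; apply: le_lt_trans NP.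
    by rewrite lerD2r Fnd// ib leqnn.
  apply: (le_trans sF); apply: ler_piMr; last by rewrite gerBl invr_ge0 exprn_ge0.
  by apply: divr_ge0 (ltW tau0); lra.
elim: N => [|N [s1 [s1P s1z s1F]]].
  exists [::]; split=> // [z i _ ib|].
    by have := Fge0 i ib; rewrite expr0 mul1r; lra.
  by rewrite /incr_sum big_nil expr0 invr1 subrr mulr0.
(* The block for shell [N] runs from [0], where [z] vanishes, to the last index [b'] under the
   ceiling of the shell. Its cost is at most [2916 * (4^N.+1 * tau)^2], and the weight [c] is the
   largest value of [1 / (F i + tau)^3] that the shell allows. *)
have exb : exists i, (i <= b)%N && (F i + tau < 4 ^+ N.+1 * tau).
  exists 0%N; rewrite leq0n F0 add0r ltr_pMl// /=.
  by rewrite exprn_egt1// ltr1n.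
have ubb i : (i <= b)%N && (F i + tau < 4 ^+ N.+1 * tau) -> (i <= b)%N.
  by case/andP.
case: (ex_maxnP exb ubb) => b' /andP[b'b Fb'] b'max.
have [||s2 [s2P s2z s2F]] := @chaining_block R F 0%N b'.
- exact: leq0n.
- by move=> i j /andP[_ ij] jb'; apply: Fnd; rewrite ij (leq_trans jb').
pose c := ((4 ^+ N * tau) ^+ 3)^-1.
have c0 : 0 <= c by rewrite invr_ge0 exprn_ge0// mulr_ge0 ?exprn_ge0 ?(ltW tau0).
exists (s1 ++ [seq (c * q.1, q.2) | q <- s2]); split.
- rewrite /admissible all_cat; apply/andP; split; first exact: s1P.
  by apply: admissible_scale => //; exact: admissible_widen s2P.
- move=> z i z0 ib FiN; rewrite incr_sum_cat incr_sum_scale.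
  have s10 : 0 <= incr_sum 4 s1 z by apply: incr_sum_ge0 s1P.
  have s20 : 0 <= incr_sum 4 s2 z by apply: incr_sum_ge0 s2P.
  have [lt|ge] := ltP (F i + tau) (4 ^+ N * tau).
    by apply: (le_trans (s1z z i z0 ib lt)); rewrite lerDl mulr_ge0.
  have ib' : (i <= b')%N by apply: b'max; rewrite ib.
  have := s2z z i; rewrite leq0n ib' z0 subr0 => /(_ isT) zi.
  suff : z i ^+ 4 / (F i + tau) ^+ 3 <= c * incr_sum 4 s2 z by lra.
  rewrite mulrC; apply: ler_pM => //.
  + by rewrite invr_ge0 exprn_ge0// addr_ge0 ?Fge0 ?(ltW tau0).
  + by rewrite exprn_even_ge0.
  + have pN : 0 < 4 ^+ N * tau by rewrite mulr_gt0 ?exprn_gt0.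
    rewrite lef_pV2 ?posrE ?exprn_gt0 ?(lt_le_trans pN ge)//.
    by rewrite lerXn2r ?nnegrE ?(ltW pN) ?(ltW (lt_le_trans pN ge)).
- rewrite incr_sum_cat incr_sum_scale.
  rewrite F0 subr0 in s2F.
  have Fb2 : F b' ^+ 2 <= (4 ^+ N.+1 * tau) ^+ 2.
    rewrite ler_sqr ?nnegrE ?Fge0 ?mulr_ge0 ?exprn_ge0 ?(ltW tau0)//.
    by apply: ltW; apply: le_lt_trans Fb'; rewrite lerDl ltW.
  have cF : c * incr_sum 2 s2 F <= c * (2916 * (4 ^+ N.+1 * tau) ^+ 2).
    by apply: (ler_wpM2l c0); apply: (le_trans s2F); apply: ler_wpM2l Fb2; lra.
  have cE : c * (2916 * (4 ^+ N.+1 * tau) ^+ 2) = 2916 * 16 / tau * (4 ^+ N)^-1.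
    rewrite /c [4 ^+ N.+1]exprS; have : (4 : R) ^+ N != 0 by rewrite expf_neq0 ?pnatr_eq0.
    by move: (4 ^+ N) => t t0; field; rewrite t0 gt_eqF.
  have e4 : (4 ^+ N.+1)^-1 = (4 ^+ N)^-1 / 4 :> R by rewrite exprS invfM mulrC.
  rewrite e4; move: s1F cF; rewrite cE.
  by clear; move: (4 ^+ N)^-1 (tau^-1) => t u; nra.
Qed.

(** * Ordered smoothers *)

Definition dotv (R : pzSemiRingType) (n : nat) (u v : 'cV[R]_n) : R :=
  (u^T *m v) 0 0.

Section dotv_theory.
Context (R : realFieldType) (n : nat).
Implicit Types u v w : 'cV[R]_n.

Lemma dotvE u v : dotv u v = \sum_i u i 0 * v i 0.
Proof. by rewrite /dotv mxE; apply: eq_bigr => i _; rewrite mxE. Qed.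

Lemma dotvC u v : dotv u v = dotv v u.
Proof. by rewrite !dotvE; apply: eq_bigr => i _; rewrite mulrC. Qed.

Lemma dotvDr u v w : dotv u (v + w) = dotv u v + dotv u w.
Proof. by rewrite /dotv mulmxDr mxE. Qed.

Lemma dotvDl u v w : dotv (v + w) u = dotv v u + dotv w u.
Proof. by rewrite dotvC dotvDr !(dotvC u). Qed.

Lemma dotvZr k u v : dotv u (k *: v) = k * dotv u v.
Proof. by rewrite /dotv -scalemxAr mxE. Qed.

Lemma dotvZl k u v : dotv (k *: u) v = k * dotv u v.
Proof. by rewrite dotvC dotvZr dotvC. Qed.

Lemma dotvNr u v : dotv u (- v) = - dotv u v.
Proof. by rewrite -scaleN1r dotvZr mulN1r. Qed.

Lemma dotvNl u v : dotv (- u) v = - dotv u v.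
Proof. by rewrite -scaleN1r dotvZl mulN1r. Qed.

Lemma dotv0r u : dotv u 0 = 0.
Proof. by rewrite /dotv mulmx0 mxE. Qed.

Lemma dotv_sumr (I : finType) u (f : I -> 'cV[R]_n) :
  dotv u (\sum_i f i) = \sum_i dotv u (f i).
Proof. by rewrite /dotv mulmx_sumr summxE. Qed.

Lemma dotv_ge0 u : 0 <= dotv u u.
Proof. by rewrite dotvE sumr_ge0// => i _; rewrite -expr2 sqr_ge0. Qed.

Lemma dotv_mulmxl m (A : 'M[R]_(n, m)) (u : 'cV[R]_m) v :
  dotv (A *m u) v = dotv u (A^T *m v).
Proof. by rewrite /dotv trmx_mul mulmxA. Qed.

Lemma dotvD_le u v : dotv (u + v) (u + v) <= 2 * dotv u u + 2 * dotv v v.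
Proof.
have := dotv_ge0 (u - v); rewrite !(dotvDl, dotvDr, dotvNl, dotvNr).
rewrite (dotvC v u); lra.
Qed.

End dotv_theory.

Definition dotvS := (@dotvDl, @dotvDr, @dotvNl, @dotvNr, @dotvZl, @dotvZr).

Definition frob2 (R : pzSemiRingType) (n : nat) (A : 'M[R]_n) : R :=
  \sum_i \sum_j A i j ^+ 2.

(** Summing over the standard basis transfers any inequality between the [|A v|^2], valid for every
    [v], to Frobenius norms. *)
Lemma frob2E (R : realFieldType) (n : nat) (A : 'M[R]_n) :
  frob2 A = \sum_j dotv (A *m delta_mx j 0) (A *m delta_mx j 0).
Proof.
rewrite /frob2 exchange_big; apply: eq_bigr => j _.
by rewrite dotvE -colE; apply: eq_bigr => i _; rewrite !mxE expr2.
Qed.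

Lemma frob2_ge0 (R : realFieldType) (n : nat) (A : 'M[R]_n) : 0 <= frob2 A.
Proof. by rewrite !sumr_ge0// => i _; rewrite sumr_ge0// => j _; rewrite sqr_ge0. Qed.

Lemma frob2_sym (R : realFieldType) (n : nat) (A : 'M[R]_n) :
  A^T = A -> frob2 A = \tr (A *m A).
Proof.
move=> As; rewrite /mxtrace; apply: eq_bigr => i _.
by rewrite mxE; apply: eq_bigr => j _; rewrite -{3}As mxE expr2.
Qed.

Definition smoother (R : realType) (n p : nat) (X : 'M[R]_(n, p))
    (K : 'M[R]_p) (l : R) : 'M[R]_n :=
  X *m invmx (X^T *m X + l *: K) *m X^T.

Section smoother_theory.
Context (R : realType) (n p : nat) (X : 'M[R]_(n, p)) (K : 'M[R]_p).
Hypothesis K_pos : posdefmx K.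

Let S (l : R) := X^T *m X + l *: K.
Let Ri (l : R) := invmx (S l).
Let A (l : R) := smoother X K l.

Lemma mulmx_tikhonov l y : X *m tikhonov X K l y = A l *m y.
Proof. by rewrite /tikhonov /A /smoother !mulmxA. Qed.

Let Str l : (S l)^T = S l.
Proof. by rewrite /S linearD/= linearZ/= trmx_mul trmxK (proj1 K_pos). Qed.

Let Ritr l : (Ri l)^T = Ri l.
Proof. by rewrite /Ri trmx_inv Str. Qed.

Lemma smoother_sym l : (smoother X K l)^T = smoother X K l.
Proof. by rewrite /smoother !trmx_mul trmxK Ritr mulmxA. Qed.

(** For [A l v = X w], the normal equations give [<X w, v> = |X w|^2 + l w^T K w >= |X w|^2];
    expanding [|X w - v|^2 >= 0] concludes. *)
Lemma smoother_contract l v : 0 <= l -> posdefmx (S l) ->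
  dotv (A l *m v) (A l *m v) <= dotv v v.
Proof.
move=> l0 Sl; have Su : S l \in unitmx := posdefmx_unit Sl.
pose w := Ri l *m (X^T *m v).
have -> : A l *m v = X *m w by rewrite /w /A /smoother !mulmxA.
have Xwv : dotv (X *m w) v = dotv (X *m w) (X *m w) + l * dotv w (K *m w).
  rewrite dotv_mulmxl [in RHS]dotv_mulmxl -dotvZr -dotvDr mulmxA scalemxAl.
  by rewrite -mulmxDl -/(S l) /w /Ri mulKVmx.
have Kw : 0 <= dotv w (K *m w).
  rewrite /dotv mulmxA; have [->|/(proj2 K_pos)/ltW//] := eqVneq w 0.
  by rewrite mulmx0 mxE.
have := dotv_ge0 (X *m w - v); rewrite !dotvS [dotv v (_ *m _)]dotvC.
have := mulr_ge0 l0 Kw; lra.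
Qed.

Let Ri_sub a b : posdefmx (S a) -> posdefmx (S b) ->
  Ri a - Ri b = (b - a) *: (Ri a *m K *m Ri b).
Proof.
move=> /posdefmx_unit Sa /posdefmx_unit Sb.
rewrite scalemxAl scalemxAr.
have -> : (b - a) *: K = S b - S a.
  by rewrite /S opprD addrACA subrr add0r scalerBl.
by rewrite mulmxBr mulmxBl /Ri mulVmx// mul1mx -mulmxA mulmxV// mulmx1.
Qed.

(** Exchanging [a] and [b] in the resolvent identity [Ri_sub] negates its left side, and [b - a]
    cancels. This symmetry stands in for a simultaneous diagonalization of [X^T X] and [K]. *)
Let RiKRi a b : posdefmx (S a) -> posdefmx (S b) ->
  Ri a *m K *m Ri b = Ri b *m K *m Ri a.
Proof.
move=> Sa Sb; have [->//|ab] := eqVneq a b.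
have ba0 : b - a != 0 by rewrite subr_eq0 eq_sym.
apply: (scalerI ba0); rewrite -Ri_sub//.
by rewrite -[b - a]opprB scaleNr -Ri_sub// opprB.
Qed.

(** Substituting [S a - a K] for the inner [X^T X] leaves [Ri b - a Ri a K Ri b] on one side and
    [Ri b - a Ri b K Ri a] on the other; these agree by [RiKRi]. *)
Lemma smoother_comm a b : posdefmx (S a) -> posdefmx (S b) ->
  A a *m A b = A b *m A a.
Proof.
move=> Sa Sb; have Sau := posdefmx_unit Sa.
rewrite /A /smoother -!mulmxA; congr (X *m _); rewrite !mulmxA; congr (_ *m _).
rewrite -!/(S _) -!/(Ri _) -!(mulmxA _ X^T X).
have -> : X^T *m X = S a - a *: K by rewrite /S addrK.
rewrite !mulmxBr !mulmxBl /Ri mulVmx// mul1mx mulmxK//.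
rewrite -!/(Ri _).
by rewrite -!scalemxAr -!scalemxAl RiKRi.
Qed.

(* With [A a - A b = (b - a) X (S a)^-1 K (S b)^-1 X^T] and
   [A b - A c = (c - b) X (S c)^-1 K (S b)^-1 X^T], the claim is
   [<X s, X r> >= 0] for [S a s = S c r]; the difference [d = s - r] satisfies
   [S a d = (c - a) K r], so that [(c - a) <X d, X r>] is
   [<G d, K^-1 G d> + a <X d, X d>] for [G = X^T X]. *)
Lemma smoother_ordered a b c v : 0 <= a -> a <= b -> b <= c ->
  posdefmx (S a) -> posdefmx (S b) -> posdefmx (S c) ->
  0 <= dotv ((A a - A b) *m v) ((A b - A c) *m v).
Proof.
move=> a0 ab bc Sa Sb Sc; have ac := le_trans ab bc.
have Sau := posdefmx_unit Sa; have Scu := posdefmx_unit Sc.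
have Ku := posdefmx_unit K_pos.
pose q := K *m (Ri b *m (X^T *m v)); pose r := Ri c *m q; pose s := Ri a *m q.
have Adiff e f : posdefmx (S e) -> posdefmx (S f) ->
    (A e - A f) *m v = (f - e) *: (X *m (Ri e *m (K *m (Ri f *m (X^T *m v))))).
  move=> Se Sf; rewrite /A /smoother -mulmxBl -mulmxBr Ri_sub//.
  by rewrite -scalemxAr -!scalemxAl !mulmxA.
have -> : (A a - A b) *m v = (b - a) *: (X *m s) by rewrite Adiff.
have -> : (A b - A c) *m v = (c - b) *: (X *m r).
  rewrite -opprB mulNmx Adiff// -scaleNr opprB; congr (_ *: (X *m _)).
rewrite dotvZl dotvZr mulr_ge0 ?subr_ge0// mulr_ge0 ?subr_ge0//.
pose d := s - r; pose G := X^T *m X.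
have Sd : S a *m d = (c - a) *: (K *m r).
  have -> : S a *m d = S c *m r - S a *m r.
    by rewrite /d mulmxBr /s /r !mulmxA !mulmxV.
  rewrite -mulmxBl scalemxAl; congr (_ *m _).
  by rewrite /S opprD addrACA subrr add0r scalerBl.
have -> : s = r + d by rewrite addrC subrK.
rewrite mulmxDr dotvDl addr_ge0 ?dotv_ge0//.
move: ac; rewrite le_eqVlt => /predU1P[ac|ac].
  suff -> : d = 0 by rewrite mulmx0 dotvC dotv0r.
  by rewrite -(mulKmx Sau d) Sd -ac subrr scale0r mulmx0.
rewrite -(@pmulr_rge0 _ (c - a)) ?subr_gt0//.
have -> : dotv (X *m d) (X *m r) = dotv (G *m d) r.
  by rewrite dotvC dotv_mulmxl dotvC /G mulmxA.
have rE : (c - a) *: r = invmx K *m (G *m d) + a *: d.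
  have -> : (c - a) *: r = invmx K *m (S a *m d).
    by rewrite Sd -scalemxAr mulKmx.
  by rewrite /S mulmxDl mulmxDr -scalemxAl -scalemxAr mulKmx.
rewrite -dotvZr rE dotvDr addr_ge0//.
  pose g := invmx K *m (G *m d).
  have -> : G *m d = K *m g by rewrite /g mulKVmx.
  rewrite dotv_mulmxl (proj1 K_pos) mulKmx// dotvC dotv_mulmxl (proj1 K_pos).
  rewrite /dotv mulmxA; have [->|/(proj2 K_pos)/ltW//] := eqVneq g 0.
  by rewrite mulmx0 mxE.
rewrite dotvZr mulr_ge0// dotvC /G -mulmxA dotvC dotv_mulmxl trmxK.
exact: dotv_ge0.
Qed.

End smoother_theory.

(** * Increments of the chaos coefficients, compared with increments of [F] *)

Section smoother_increments.
Context (R : realType) (n p : nat) (X : 'M[R]_(n, p)) (K : 'M[R]_p).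
Hypothesis K_pos : posdefmx K.

Let feasible (l : R) := 0 <= l /\ posdefmx (X^T *m X + l *: K).
Let A (l : R) := smoother X K l.
Let B (l0 l : R) := A l - A l0.

(** With [y = mu + e], [quad_coef] and [lin_coef] collect the terms of degree two and one in [e] of
    [2 <e, B y> - |B y|^2 / 2]. *)
Definition quad_coef (l0 l : R) : 'M[R]_n :=
  2 *: B l0 l - 2^-1 *: (B l0 l *m B l0 l).

Definition lin_coef (mu : 'cV[R]_n) (l0 l : R) : 'cV[R]_n :=
  (2 *: B l0 l - B l0 l *m B l0 l) *m mu.

(** This is [F]: the bias part and the variance part of the mean of [|B y|^2]. *)
Definition penalty (sigma : R) (mu : 'cV[R]_n) (l0 l : R) : R :=
  dotv (B l0 l *m mu) (B l0 l *m mu) + sigma ^+ 2 * frob2 (B l0 l).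

Lemma penalty_id sigma mu l0 : penalty sigma mu l0 l0 = 0.
Proof.
rewrite /penalty /B subrr mul0mx dotv0r add0r /frob2 big1 ?mulr0// => i _.
by rewrite big1// => j _; rewrite mxE expr0n.
Qed.

(** Since the smoothers commute, a difference of squares factors; an increment of [B^2] is then an
    increment of [A] times a bounded matrix. *)
Let quad_coefB l0 a b : feasible l0 -> feasible a -> feasible b ->
  B l0 b *m B l0 b - B l0 a *m B l0 a = (B l0 b + B l0 a) *m (A b - A a).
Proof.
move=> [_ ?] [_ ?] [_ ?].
have -> : A b - A a = B l0 b - B l0 a by rewrite /B opprB addrA subrK.
have BC : B l0 a *m B l0 b = B l0 b *m B l0 a.
  have AC e f : posdefmx (X^T *m X + e *: K) -> posdefmx (X^T *m X + f *: K) ->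
      A e *m A f = A f *m A e by exact: smoother_comm.
  have := AC a b; have := AC a l0; have := AC b l0.
  rewrite /B; move: (A a) (A b) (A l0) => P Q W QW PW PQ.
  rewrite !mulmxBl !mulmxBr QW// PW// PQ//.
  by rewrite opprD addrACA -opprD.
by move: (B l0 a) (B l0 b) BC => P Q PQ; rewrite mulmxDl !mulmxBr PQ addrA subrK.
Qed.

Let B_le l0 a v : feasible l0 -> feasible a ->
  dotv (B l0 a *m v) (B l0 a *m v) <= 4 * dotv v v.
Proof.
move=> [l00 Sl0] [a0 Sa]; rewrite mulmxBl.
apply: (le_trans (dotvD_le _ _)); rewrite dotvNl dotvNr opprK.
have := smoother_contract K_pos v a0 Sa.
have := smoother_contract K_pos v l00 Sl0; rewrite -/(A _); lra.
Qed.

Let sumB_le l0 a b v : feasible l0 -> feasible a -> feasible b ->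
  dotv ((B l0 b + B l0 a) *m v) ((B l0 b + B l0 a) *m v) <= 16 * dotv v v.
Proof.
move=> l0P aP bP; rewrite mulmxDl; apply: (le_trans (dotvD_le _ _)).
by have := B_le v l0P aP; have := B_le v l0P bP; lra.
Qed.

Let quad_coef_le l0 a b v : feasible l0 -> feasible a -> feasible b ->
  dotv ((quad_coef l0 b - quad_coef l0 a) *m v)
       ((quad_coef l0 b - quad_coef l0 a) *m v)
  <= 16 * dotv ((A b - A a) *m v) ((A b - A a) *m v).
Proof.
move=> l0P aP bP.
have -> : quad_coef l0 b - quad_coef l0 a = 2 *: (A b - A a)
    - 2^-1 *: ((B l0 b + B l0 a) *m (A b - A a)).
  rewrite -quad_coefB// /quad_coef.
  have -> : A b - A a = B l0 b - B l0 a by rewrite /B opprB addrA subrK.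
  by rewrite !scalerBr opprD addrACA -opprD.
rewrite mulmxBl -!scalemxAl -mulmxA; apply: (le_trans (dotvD_le _ _)).
rewrite !dotvS; have := sumB_le ((A b - A a) *m v) l0P aP bP.
by have := dotv_ge0 ((A b - A a) *m v); lra.
Qed.

Let lin_coef_le l0 a b mu : feasible l0 -> feasible a -> feasible b ->
  dotv (lin_coef mu l0 b - lin_coef mu l0 a)
       (lin_coef mu l0 b - lin_coef mu l0 a)
  <= 40 * dotv ((A b - A a) *m mu) ((A b - A a) *m mu).
Proof.
move=> l0P aP bP.
have -> : lin_coef mu l0 b - lin_coef mu l0 a = 2 *: ((A b - A a) *m mu)
    - (B l0 b + B l0 a) *m ((A b - A a) *m mu).
  rewrite mulmxA -quad_coefB// /lin_coef -mulmxBl scalemxAl -mulmxBl.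
  congr (_ *m _).
  have -> : A b - A a = B l0 b - B l0 a by rewrite /B opprB addrA subrK.
  by move: (B l0 a) (B l0 b) => P Q; rewrite scalerBr opprD addrACA -opprD.
apply: (le_trans (dotvD_le _ _)); rewrite !dotvS.
have := sumB_le ((A b - A a) *m mu) l0P aP bP.
by have := dotv_ge0 ((A b - A a) *m mu); lra.
Qed.

(** Expanding [|B_b v|^2] with [B_b = B_a + (A_b - A_a)], the cross term is nonnegative by
    [smoother_ordered], as both differences point away from [l0]. *)
Let ordered_incr_le l0 a b v : feasible l0 -> feasible a -> feasible b ->
  (l0 <= a <= b) || (b <= a <= l0) ->
  dotv ((A b - A a) *m v) ((A b - A a) *m v)
  <= dotv (B l0 b *m v) (B l0 b *m v) - dotv (B l0 a *m v) (B l0 a *m v).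
Proof.
move=> [l00 Sl0] [a0 Sa] [b0 Sb] order.
have cross : 0 <= dotv (B l0 a *m v) ((A b - A a) *m v).
  case/orP: order => /andP[ab bc].
    have := smoother_ordered K_pos v l00 ab bc Sl0 Sa Sb.
    have neg (P Q : 'M[R]_n) : (P - Q) *m v = - ((Q - P) *m v).
      by rewrite -mulNmx opprB.
    by rewrite (neg (A l0) (A a)) (neg (A a) (A b)) dotvNl dotvNr opprK.
  by have := smoother_ordered K_pos v b0 ab bc Sb Sa Sl0; rewrite dotvC.
have -> : B l0 b *m v = B l0 a *m v + (A b - A a) *m v.
  by rewrite -mulmxDl /B [X in _ = X *m _]addrC subrKA.
move: (B l0 a *m v) ((A b - A a) *m v) cross => P Q PQ.
by rewrite !dotvS (dotvC Q P); lra.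
Qed.

(** The constant [40 = 2 * 4 + 2 * 16] comes from the linear coefficient; the quadratic one only
    needs [16]. *)
Lemma increment_le_penalty sigma mu l0 a b :
  feasible l0 -> feasible a -> feasible b -> (l0 <= a <= b) || (b <= a <= l0) ->
  dotv (lin_coef mu l0 b - lin_coef mu l0 a)
       (lin_coef mu l0 b - lin_coef mu l0 a)
  + sigma ^+ 2 * frob2 (quad_coef l0 b - quad_coef l0 a)
  <= 40 * (penalty sigma mu l0 b - penalty sigma mu l0 a).
Proof.
move=> l0P aP bP order.
have lin := lin_coef_le mu l0P aP bP.
have mu_incr := ordered_incr_le mu l0P aP bP order.
have quad : frob2 (quad_coef l0 b - quad_coef l0 a)
    <= 16 * (frob2 (B l0 b) - frob2 (B l0 a)).
  rewrite !frob2E -sumrB mulr_sumr; apply: ler_sum => j _.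
  apply: (le_trans (quad_coef_le _ l0P aP bP)).
  by rewrite ler_pM2l// ordered_incr_le.
have frob_incr : 0 <= frob2 (B l0 b) - frob2 (B l0 a).
  rewrite -(@pmulr_rge0 _ 16)//; apply: le_trans quad; exact: frob2_ge0.
have := ler_wpM2l (sqr_ge0 sigma) quad.
have := mulr_ge0 (sqr_ge0 sigma) frob_incr.
move: lin mu_incr; rewrite /penalty.
move: (dotv _ _) (dotv _ _) (dotv _ _) (dotv _ _) (sigma ^+ 2).
move: (frob2 _) (frob2 _) (frob2 _) => f1 f2 f3 d1 d2 d3 d4 s2; lra.
Qed.

End smoother_increments.

(* First-order optimality of [theta] in the direction of the vertex [j0]. *)
Lemma Q_argmin_excess (R : realType) (n p M : nat) (X : 'M[R]_(n, p))
    (K : 'M[R]_p) (lam : 'I_M -> R) (sigma : R) (mu y : 'cV[R]_n)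
    (theta : 'cV[R]_M) (j0 : 'I_M) (m : 'I_M -> 'cV[R]_n) :
  (forall j, m j = X *m tikhonov X K (lam j) y) ->
  is_argmin (@simplex R M) (Q_obj X K lam sigma y) theta ->
  l2norm (X *m aggregate X K lam y theta - mu) ^+ 2 <=
  l2norm (m j0 - mu) ^+ 2 + \sum_j theta j 0 *
    (2 * dotv (y - mu) (m j - m j0)
     - 2 * sigma ^+ 2 * (tikhonov_df X K (lam j) - tikhonov_df X K (lam j0))
     - 2^-1 * dotv (m j - m j0) (m j - m j0)).
Proof.
move=> mE [[theta0 theta1] theta_min].
pose df j := tikhonov_df X K (lam j).
pose x j := m j - m j0; pose q := m j0 - y.
have sum_x (t : 'cV[R]_M) : \sum_j t j 0 = 1 ->
    \sum_j t j 0 *: m j = m j0 + \sum_j t j 0 *: x j.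
  move=> t1; rewrite -{1}[m j0]scale1r -t1 scaler_suml -big_split/=.
  by apply: eq_bigr => j _; rewrite -scalerDr /x addrC subrK.
pose xs := \sum_j theta j 0 *: x j.
pose lin (t : 'cV[R]_M) := 2 * sigma ^+ 2 * (\sum_j t j 0 * df j)
  + 2^-1 * \sum_j t j 0 * l2norm (m j - y) ^+ 2.
have QE (t : 'cV[R]_M) : \sum_j t j 0 = 1 -> Q_obj X K lam sigma y t =
    2^-1 * dotv (q + \sum_j t j 0 *: x j) (q + \sum_j t j 0 *: x j) + lin t.
  move=> t1; rewrite /Q_obj; under eq_bigr do rewrite -mE.
  under [in X in _ + 2^-1 * X]eq_bigr do rewrite -mE.
  rewrite sum_x// l2norm_sqr -/(dotv _ _) [_ - y]addrAC.
  by rewrite /lin addrA.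
pose e0 : 'cV[R]_M := delta_mx j0 0.
have sum_e0 (V : lmodType R) (f : 'I_M -> V) : \sum_j e0 j 0 *: f j = f j0.
  rewrite (bigD1 j0)//= big1 ?addr0 => [|j /negPf jj0]; rewrite mxE ?eqxx.
    by rewrite scale1r.
  by rewrite jj0 scale0r.
have sum_e0R (f : 'I_M -> R) : \sum_j e0 j 0 * f j = f j0 := sum_e0 R^o f.
have e01 : \sum_j e0 j 0 = 1.
  by rewrite -[RHS](sum_e0R (fun=> 1)); apply: eq_bigr => j _; rewrite mulr1.
pose seg t : 'cV[R]_M := (1 - t) *: theta + t *: e0.
have segE t j : seg t j 0 = (1 - t) * theta j 0 + t * e0 j 0.
  by rewrite /seg mxE; congr (_ + _); rewrite mxE.
have sum_seg t (V : lmodType R) (f : 'I_M -> V) :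
    \sum_j seg t j 0 *: f j = (1 - t) *: (\sum_j theta j 0 *: f j) + t *: f j0.
  rewrite -(sum_e0 _ f) !scaler_sumr -big_split/=; apply: eq_bigr => j _.
  by rewrite segE [LHS]scalerDl !scalerA.
have sum_segR t (f : 'I_M -> R) :
    \sum_j seg t j 0 * f j = (1 - t) * (\sum_j theta j 0 * f j) + t * f j0.
  exact: (sum_seg t R^o f).
have seg1 t : \sum_j seg t j 0 = 1.
  transitivity (\sum_j seg t j 0 * 1); first by apply: eq_bigr => j _; rewrite mulr1.
  rewrite sum_segR; under eq_bigr do rewrite mulr1.
  by rewrite theta1; lra.
have seg_simplex t : 0 <= t <= 1 -> simplex (seg t).
  move=> /andP[t0 t1]; split; last exact: seg1.
  by move=> j; rewrite segE addr_ge0 ?mulr_ge0 ?subr_ge0// mxE ler0n.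
have x0 : x j0 = 0 by rewrite /x subrr.
pose L0 := lin e0 - lin theta.
have lin_seg t : lin (seg t) = lin theta + t * L0.
  by rewrite /L0 /lin !sum_segR !sum_e0R; lra.
(* Along the segment towards the vertex [j0] the mixture of the [x j] is [(1 - t) xs], because
   [x j0 = 0]; the objective minus its value at [theta] is thus an explicit quadratic in [t]. *)
have opt t : 0 <= t <= 1 ->
    0 <= t * (L0 - dotv (q + xs) xs) + t ^+ 2 * (2^-1 * dotv xs xs).
  move=> /seg_simplex /theta_min; rewrite !QE ?seg1// lin_seg sum_seg x0.
  rewrite scaler0 addr0 -/xs; move: {+}xs {+}q {+}L0 (lin theta) => P Q L W.
  by rewrite !dotvS (dotvC P Q); nra.
have first_order : 0 <= L0 - dotv (q + xs) xs.
  rewrite leNgt; apply/negP => neg.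
  set a := L0 - _ in opt neg; set b := 2^-1 * _ in opt.
  have b0 : 0 <= b by rewrite mulr_ge0 ?dotv_ge0 ?invr_ge0.
  (* If the slope [a] were negative, this point of []0, 1]] would give
     [a + t b = - a^2 / (b - a) < 0]; no derivative is taken. *)
  pose t := - a / (b - a).
  have ba : 0 < b - a by lra.
  have t01 : 0 < t <= 1.
    by rewrite divr_gt0 ?oppr_gt0//= ler_pdivrMr// mul1r lerDr.
  have := opt t; case/andP: t01 => t0 t1; rewrite (ltW t0) t1 => /(_ isT).
  rewrite expr2 -mulrA -mulrDr pmulr_rge0//.
  have -> : a + t * b = - a ^+ 2 / (b - a).
    by rewrite /t; field; rewrite gt_eqF.
  rewrite mulNr oppr_ge0 leNgt divr_gt0// exprn_even_gt0//=.
  by rewrite lt_eqF.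
have sq_my j : l2norm (m j - y) ^+ 2 = dotv q q + 2 * dotv q (x j) + dotv (x j) (x j).
  rewrite l2norm_sqr -/(dotv _ _).
  have -> : m j - y = q + x j by rewrite /q /x [RHS]addrC subrKA.
  by move: (x j) {+}q => P Q; rewrite !dotvS (dotvC P Q); lra.
(* The averaged residuals, the last term of the objective, supply both the second [- <q, xs>] needed
   to match the expansion of the loss and the negative term [- |x_j|^2 / 2] that will absorb the
   fluctuations. *)
have L0E : L0 = 2 * sigma ^+ 2 * (df j0 - \sum_j theta j 0 * df j)
    - dotv q xs - 2^-1 * \sum_j theta j 0 * dotv (x j) (x j).
  rewrite /L0 /lin !sum_e0R sq_my x0 !dotv0r.
  have -> : \sum_j theta j 0 * l2norm (m j - y) ^+ 2 =
      dotv q q + 2 * dotv q xs + \sum_j theta j 0 * dotv (x j) (x j).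
    have qE : dotv q q = \sum_j theta j 0 * dotv q q by rewrite -mulr_suml theta1 mul1r.
    rewrite {1}qE dotv_sumr mulr_sumr -!big_split/=; apply: eq_bigr => j _.
    by rewrite sq_my dotvZr; ring.
  by clear; lra.
have aggE : X *m aggregate X K lam y theta = m j0 + xs.
  rewrite /aggregate mulmx_sumr -sum_x//; apply: eq_bigr => j _.
  by rewrite -scalemxAr mE.
rewrite aggE !l2norm_sqr -!/(dotv _ _).
have -> : m j0 + xs - mu = (m j0 - mu) + xs by rewrite addrAC.
have -> : \sum_j theta j 0 * (2 * dotv (y - mu) (m j - m j0)
     - 2 * sigma ^+ 2 * (tikhonov_df X K (lam j) - tikhonov_df X K (lam j0))
     - 2^-1 * dotv (m j - m j0) (m j - m j0)) =
   2 * dotv (y - mu) xs - 2 * sigma ^+ 2 * (\sum_j theta j 0 * df j - df j0)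
   - 2^-1 * \sum_j theta j 0 * dotv (x j) (x j).
  have dfE : df j0 = \sum_j theta j 0 * df j0 by rewrite -mulr_suml theta1 mul1r.
  rewrite {1}dfE dotv_sumr -sumrB !mulr_sumr -!sumrB.
  apply: eq_bigr => j _; rewrite dotvZr -!/(df _) -/(x _).
  by move: (x j) => xj; ring.
have -> : y - mu = (m j0 - mu) - q by rewrite /q opprB [RHS]addrC subrKA.
move: first_order; rewrite L0E !dotvS (dotvC xs (m j0)) (dotvC xs mu).
by rewrite ?(dotvC xs q); lra.
Qed.

(** * Gaussian moments *)

Section density.
Local Open Scope ereal_scope.
Context d1 d2 (X : measurableType d1) (Y : measurableType d2) (R : realType).
Variables (mu : {measure set X -> \bar R}) (nu : {measure set Y -> \bar R}).
Variables (phi : X -> Y) (h : X -> R) (c : R).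
Hypotheses (mphi : measurable_fun setT phi) (mh : measurable_fun setT h).
Hypotheses (h0 : forall x, (0 <= h x)%R) (c0 : (0 <= c)%R).
Hypothesis mu_nu : forall B, measurable B ->
  \int[mu]_(x in phi @^-1` B) (h x)%:E = c%:E * nu B.

Import HBNNSimple.

(** Simple functions and monotone convergence extend [mu_nu] from sets to functions. It is used with
    [phi] the identity and [h] the normal density, and with [phi] one noise coordinate and [h] a
    product over the others, whose total mass is [c]. *)
Lemma ge0_integral_density (g : Y -> R) :
  measurable_fun setT g -> (forall y, (0 <= g y)%R) ->
  \int[mu]_x (g (phi x) * h x)%:E = c%:E * \int[nu]_y (g y)%:E.
Proof.
move=> mg g0; have mg' : measurable_fun setT (EFin \o g) by exact/measurable_EFinP.
pose g_ := nnsfun_approx measurableT mg'.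
have mphiB B : measurable B -> measurable (phi @^-1` B).
  by move=> mB; rewrite -(setTI (_ @^-1` _)); exact: mphi.
have g_cvg y : g_ n y @[n --> \oo] --> g y.
  have g'0 z : [set: Y] z -> 0 <= (EFin \o g) z by move=> _; rewrite lee_fin.
  exact: fine_cvg (cvg_nnsfun_approx measurableT mg' g'0 (I : [set: Y] y)).
have nd_g_ m n y : (m <= n)%N -> (g_ m y <= g_ n y)%R.
  by move=> mn; exact/lefP/nd_nnsfun_approx.
have lim1 : \int[mu]_x (g_ n (phi x) * h x)%:E @[n --> \oo] -->
    \int[mu]_x (g (phi x) * h x)%:E.
  have -> : \int[mu]_x (g (phi x) * h x)%:E =
      \int[mu]_x limn (fun n => (g_ n (phi x) * h x)%:E).
    apply: eq_integral => x _; apply/esym/cvg_lim => //.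
    apply: cvg_EFin; first exact: nearW.
    exact: cvgMr_tmp.
  apply: cvg_monotone_convergence => //.
  - move=> n; apply/measurable_EFinP/measurable_funM => //.
    exact: measurableT_comp.
  - by move=> n x _; rewrite lee_fin mulr_ge0.
  - by move=> x _ m n mn; rewrite lee_fin ler_wpM2r// nd_g_.
have lim2 : \int[nu]_y (g_ n y)%:E @[n --> \oo] --> \int[nu]_y (g y)%:E.
  have -> : \int[nu]_y (g y)%:E = \int[nu]_y limn (fun n => (g_ n y)%:E).
    apply: eq_integral => y _; apply/esym/cvg_lim => //.
    by apply: cvg_EFin; [exact: nearW|exact: g_cvg].
  apply: cvg_monotone_convergence => //.
  - by move=> n; apply/measurable_EFinP.
  - by move=> n x _; rewrite lee_fin.
  - by move=> x _ m n mn; rewrite lee_fin nd_g_.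
apply: (cvg_unique _ lim1) => //.
have -> : (fun n => \int[mu]_x (g_ n (phi x) * h x)%:E) =
    (fun n => c%:E * \int[nu]_y (g_ n y)%:E).
  apply/funext => n.
  rewrite integralT_nnsfun sintegralE.
  transitivity (\sum_(k \in range (g_ n)) \int[mu]_x
      (k * (\1_(phi @^-1` (g_ n @^-1` [set k])) x * h x))%:E).
    rewrite -ge0_integral_fsum//.
    - apply: eq_integral => x _; rewrite fsumEFin// fimfunE mulr_fsuml.
      by congr (_%:E); apply: eq_fsbigr => k _; rewrite mulrA.
    - move=> k; apply/measurable_EFinP; apply: measurable_funM => //.
      by apply: measurable_funM => //; exact: measurable_indic (mphiB _ _).
    - move=> k x _; rewrite lee_fin mulrA mulr_ge0//.
      exact: (nnfun_muleindic_ge0).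
  rewrite ge0_mule_fsumr; last by move=> k; exact: nnsfun_mulemu_ge0.
  apply: eq_fsbigr => k _.
  rewrite muleCA -mu_nu//.
  have [k0|k0] := leP 0%R k; last first.
    rewrite preimage_nnfun0// preimage_set0 integral_set0 mule0.
    by rewrite integral0_eq// => x _; rewrite indic0 mul0r mulr0.
  under eq_integral do rewrite EFinM.
  rewrite ge0_integralZl_EFin//.
  - congr (_ * _); rewrite [RHS]integral_mkcond; apply: eq_integral => x _.
    by rewrite patchE indicE; case: ifP => _; rewrite (mul1r, mul0r).
  - by move=> x _; rewrite lee_fin mulr_ge0.
  - apply/measurable_EFinP; apply: measurable_funM => //.
    exact: measurable_indic (mphiB _ _).
by apply: cvgeZl.
Qed.
End density.

Section real_integrable.
Context (R : realType) (d : measure_display) (T : measurableType d).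
Variable P : probability T R.

Definition integrableR (f : T -> R) := P.-integrable setT (EFin \o f).

Lemma integrableR_cst (c : R) : integrableR (cst c).
Proof. exact: finite_measure_integrable_cst. Qed.

Lemma integrableRD f g : integrableR f -> integrableR g -> integrableR (fun t => f t + g t).
Proof. by move=> intf intg; exact: (integrableD measurableT intf intg). Qed.

Lemma integrableRZ c f : integrableR f -> integrableR (fun t => c * f t).
Proof. by move=> intf; exact: (integrableZl measurableT c intf). Qed.

Lemma integrableR_norm f : integrableR f -> integrableR (fun t => `|f t|).
Proof. by move=> intf; exact: (integrable_abse intf). Qed.

Lemma RintD f g : integrableR f -> integrableR g ->
  \int[P]_t (f t + g t) = \int[P]_t f t + \int[P]_t g t.
Proof. by move=> *; rewrite RintegralD. Qed.

Lemma RintZ c f : integrableR f -> \int[P]_t (c * f t) = c * \int[P]_t f t.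
Proof. by move=> *; rewrite RintegralZl. Qed.

Lemma Rint_cst c : \int[P]_t c = c.
Proof. by rewrite /Rintegral integral_cst//= probability_setT mule1. Qed.

Lemma Rint_le f g : integrableR f -> integrableR g -> (forall t, f t <= g t) ->
  \int[P]_t f t <= \int[P]_t g t.
Proof. by move=> *; apply: le_Rintegral. Qed.

End real_integrable.

Section gaussian_moments.
Context (R : realType) (d : measure_display) (T : measurableType d).
Context (P : probability T R) (Z : {RV P >-> R}) (sigma : R).
Hypotheses (sigma0 : 0 < sigma)
  (Zlaw : forall B, measurable B -> distribution P Z B = normal_prob 0 sigma B).

Let sigma_neq0 : sigma != 0. Proof. by rewrite gt_eqF. Qed.

Lemma gaussian_integral (g : R -> R) :
  measurable_fun setT g -> (forall x, 0 <= g x) ->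
  (\int[P]_t (g (Z t))%:E =
   \int[lebesgue_measure]_x (g x * normal_pdf 0 sigma x)%:E)%E.
Proof.
move=> mg g0; transitivity (\int[distribution P Z]_x (g x)%:E)%E.
  by rewrite ge0_integral_distribution//; exact/measurable_EFinP.
rewrite -[LHS]mul1e; apply/esym.
have pdfP B : measurable B ->
    (\int[lebesgue_measure]_(x in idfun @^-1` B) (normal_pdf 0 sigma x)%:E =
     1%:E * distribution P Z B)%E by move=> mB; rewrite mul1e Zlaw.
have := @ge0_integral_density _ _ _ _ R (@lebesgue_measure R) (distribution P Z)
  idfun (normal_pdf 0 sigma) 1.
move=> /(_ (@measurable_id _ _ _) (@measurable_normal_pdf R 0 sigma)).
by move=> /(_ (@normal_pdf_ge0 R 0 sigma) pdfP g mg g0).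
Qed.

(** Completing the square turns [exp (h x)] times the density into a multiple of the normal density
    centered at [h sigma^2]. *)
Lemma gaussian_mgf (h : R) :
  (\int[P]_t (expR (h * Z t))%:E = (expR (h ^+ 2 * sigma ^+ 2 / 2))%:E)%E.
Proof.
rewrite (@gaussian_integral (fun x => expR (h * x))); first last.
- by move=> x; exact: expR_ge0.
- by apply: measurableT_comp => //; exact: measurable_funM.
transitivity (\int[lebesgue_measure]_x ((expR (h ^+ 2 * sigma ^+ 2 / 2))%:E *
    (normal_pdf (h * sigma ^+ 2) sigma x)%:E))%E.
  apply: eq_integral => x _; rewrite !normal_pdfE// -EFinM; congr (_%:E).
  rewrite mulrCA [RHS]mulrCA -!expRD; congr (_ * expR _).
  by field.
rewrite ge0_integralZl_EFin//.
- by rewrite integral_normal_pdf mule1.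
- by move=> x _; rewrite lee_fin normal_pdf_ge0.
- by apply/measurable_EFinP; exact: measurable_normal_pdf.
Qed.

(** The exponent is chosen so that the integrand becomes [s] times the normal density of standard
    deviation [s sigma]. Values of [s] on both sides of [1] will pin down the variance. *)
Lemma gaussian_rescale (s : R) : 0 < s ->
  (\int[P]_t (expR (- (s ^- 2 - 1) / (2 * sigma ^+ 2) * Z t ^+ 2))%:E = s%:E)%E.
Proof.
move=> s0; set c := - (s ^- 2 - 1) / _.
rewrite (@gaussian_integral (fun x => expR (c * x ^+ 2))); first last.
- by move=> x; exact: expR_ge0.
- by apply: measurableT_comp => //; apply: measurable_funM => //; exact: exprn_measurable.
have ss0 : s * sigma != 0 by rewrite mulf_neq0 ?gt_eqF.
transitivity (\int[lebesgue_measure]_x (s%:E *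
    (normal_pdf 0 (s * sigma) x)%:E))%E.
  apply: eq_integral => x _; rewrite !normal_pdfE// -EFinM; congr (_%:E).
  have -> : normal_peak (s * sigma) = s^-1 * normal_peak sigma.
    rewrite /normal_peak -invfM; congr (_^-1).
    rewrite -{2}(ger0_norm (ltW s0)) -sqrtr_sqr -sqrtrM ?sqr_ge0//.
    by congr (Num.sqrt _); ring.
  have <- : expR (c * x ^+ 2) * normal_fun 0 sigma x = normal_fun 0 (s * sigma) x.
    rewrite /normal_fun -expRD; congr expR.
    by rewrite /c; field; rewrite sigma_neq0 gt_eqF.
  by field; rewrite gt_eqF.
rewrite ge0_integralZl_EFin ?(ltW s0)//.
- by rewrite integral_normal_pdf mule1.
- by move=> x _; rewrite lee_fin normal_pdf_ge0.
- by apply/measurable_EFinP; exact: measurable_normal_pdf.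
Qed.

Lemma normrX_le_expR (x : R) k : `|x| ^+ k <= k`!%:R * (expR x + expR (- x)).
Proof.
have le_exp : expR `|x| <= expR x + expR (- x).
  by case: (ler0P x) => _; rewrite (lerDl, lerDr) expR_ge0.
apply: (@le_trans _ _ (k`!%:R * expR `|x|)); last by rewrite ler_pM2l ?ltr0n ?fact_gt0.
case: k => [|k].
  rewrite expr0 mul1r; apply: le_trans (expR_ge1Dx `|x|).
  by rewrite lerDl.
rewrite mulrC -ler_pdivrMr ?ltr0n ?fact_gt0//.
by apply: le_trans (expR_ge1Dxn k (normr_ge0 x)); rewrite lerDr.
Qed.

Let integrable_expR h : integrableR P (fun t => expR (h * Z t)).
Proof.
apply/integrableP; split.
  by apply/measurable_EFinP; apply: measurableT_comp => //; exact: measurable_funM.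
under eq_integral do rewrite /= ger0_norm ?expR_ge0//.
by rewrite gaussian_mgf ltry.
Qed.

Lemma gaussian_integrableX k : integrableR P (fun t => Z t ^+ k).
Proof.
apply: (@le_integrable _ _ _ P setT _ _
  (fun t => (k`!%:R * (expR (1 * Z t) + expR (-1 * Z t)))%:E)) => //.
- by apply/measurable_EFinP; exact: measurable_funX.
- move=> t _; rewrite mul1r mulN1r !abse_EFin lee_fin normrX.
  by rewrite (le_trans (normrX_le_expR _ _))// ler_norm.
- by apply: integrableRZ; apply: integrableRD.
Qed.

Let int_expR h : \int[P]_t expR (h * Z t) = expR (h ^+ 2 * sigma ^+ 2 / 2).
Proof. by rewrite /Rintegral gaussian_mgf. Qed.

(** A power of [Z / sigma] is dominated by [k!] times two exponentials, each with mean
    [exp (1/2)]. *)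
Lemma gaussian_moment_le k :
  \int[P]_t (`|Z t| ^+ k) <= 2 * expR 2^-1 * k`!%:R * sigma ^+ k.
Proof.
pose h := sigma^-1; pose c := sigma ^+ k * k`!%:R.
have intE : integrableR P (fun t => expR (h * Z t) + expR (- h * Z t)) by exact: integrableRD.
apply: (@le_trans _ _ (\int[P]_t (c * (expR (h * Z t) + expR (- h * Z t))))).
  apply: Rint_le => [||t].
  - by under eq_fun do rewrite -normrX; exact/integrableR_norm/gaussian_integrableX.
  - exact: integrableRZ.
  have -> : `|Z t| ^+ k = sigma ^+ k * `|h * Z t| ^+ k.
    rewrite normrM exprMn mulrA -exprMn ger0_norm ?invr_ge0 ?(ltW sigma0)//.
    by rewrite mulfV// expr1n mul1r.
  by rewrite /c -mulrA ler_pM2l ?exprn_gt0// mulNr normrX_le_expR.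
rewrite RintZ// RintD// !int_expR sqrrN /h -exprMn mulVf// expr1n mul1r /c.
by move: (expR _) => e; lra.
Qed.

(** From [1 + h Z <= exp (h Z)] and the generating function, [h m] is at most of order [h^2]; a
    small [h] of the sign of [m] contradicts [m != 0]. *)
Lemma gaussian_mean : \int[P]_t Z t = 0.
Proof.
have intZ : integrableR P Z.
  by have := gaussian_integrableX 1.
set m := \int[P]_t Z t; apply/eqP/negPn/negP => m0.
have key h : h * m <= expR (h ^+ 2 * sigma ^+ 2 / 2) - 1.
  rewrite lerBrDl -int_expR.
  have -> : 1 + h * m = \int[P]_t (1 + h * Z t).
    by rewrite RintD ?RintZ ?Rint_cst//; [exact: integrableR_cst|exact: integrableRZ].
  apply: Rint_le => [||t]; [|exact: integrable_expR|exact: expR_ge1Dx].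
  by apply: integrableRD; [exact: integrableR_cst|exact: integrableRZ].
have exp_le (u : R) : 0 <= u <= 2^-1 -> expR u - 1 <= 2 * u.
  move=> u01; have u1 : 0 < 1 - u by lra.
  have : expR u <= (1 - u)^-1.
    rewrite -[u in expR u]opprK expRN lef_pV2 ?posrE ?expR_gt0//.
    exact: expR_ge1Dx.
  move=> eu; rewrite lerBlDl; apply: (le_trans eu).
  by rewrite -[_^-1]mul1r ler_pdivrMr//; nra.
(* With [h = t m], this choice keeps the exponent below [1/2], where [exp u - 1 <= 2 u], and makes
   [t sigma^2 < 1], so that [t m^2 <= t m^2 * (t sigma^2)] is absurd. *)
pose t := (1 + m ^+ 2 * sigma ^+ 2 + sigma ^+ 2)^-1.
have m2 : 0 < m ^+ 2 by rewrite exprn_even_gt0.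
have s2 : 0 < sigma ^+ 2 by rewrite exprn_gt0.
have D0 : 0 < 1 + m ^+ 2 * sigma ^+ 2 + sigma ^+ 2.
  have := mulr_gt0 m2 s2; lra.
have t0 : 0 < t by rewrite invr_gt0.
have tD : t * (1 + m ^+ 2 * sigma ^+ 2 + sigma ^+ 2) = 1 by rewrite mulVf ?gt_eqF.
have tms0 : 0 <= t * (m ^+ 2 * sigma ^+ 2).
  by apply: mulr_ge0 (ltW t0) (mulr_ge0 (ltW m2) (ltW s2)).
have ts0 : 0 < t * sigma ^+ 2 by rewrite mulr_gt0.
have t1 : t <= 1 by move: tD; rewrite !mulrDr mulr1; lra.
have tms : t * (m ^+ 2 * sigma ^+ 2) <= 1 by move: tD; rewrite !mulrDr mulr1; lra.
have ts : t * sigma ^+ 2 < 1 by move: tD; rewrite !mulrDr mulr1; lra.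
have uE : (t * m) ^+ 2 * sigma ^+ 2 / 2 = t * (t * (m ^+ 2 * sigma ^+ 2)) / 2 by ring.
have u01 : 0 <= (t * m) ^+ 2 * sigma ^+ 2 / 2 <= 2^-1.
  have : t * (t * (m ^+ 2 * sigma ^+ 2)) <= 1 by rewrite mulr_ile1// ltW.
  have : 0 <= t * (t * (m ^+ 2 * sigma ^+ 2)) by rewrite mulr_ge0// ltW.
  by rewrite uE => ? ?; apply/andP; split; lra.
have := le_trans (key (t * m)) (exp_le _ u01).
have -> : 2 * ((t * m) ^+ 2 * sigma ^+ 2 / 2) = t * m ^+ 2 * (t * sigma ^+ 2) by field.
have -> : t * m * m = t * m ^+ 2 * 1 by ring.
by rewrite (ler_pM2l (mulr_gt0 t0 m2)) leNgt ts.
Qed.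

(** The bound [1 + c Z^2 <= exp (c Z^2)] is integrated with [gaussian_rescale]; [c] changes sign at
    [s = 1], which yields upper and lower bounds at once. *)
Lemma gaussian_variance : \int[P]_t (Z t ^+ 2) = sigma ^+ 2.
Proof.
have intZ2 : integrableR P (fun t => Z t ^+ 2) := gaussian_integrableX 2.
set m := \int[P]_t _.
have key s : 0 < s -> 0 <= (1 - s) * ((1 + s) * m - 2 * s ^+ 2 * sigma ^+ 2).
  move=> s0; set c := - (s ^- 2 - 1) / (2 * sigma ^+ 2).
  have cm : 1 + c * m <= s.
    have -> : 1 + c * m = \int[P]_t (1 + c * Z t ^+ 2).
      by rewrite RintD ?RintZ ?Rint_cst//; [exact: integrableR_cst|exact: integrableRZ].
    have sE : \int[P]_t expR (c * Z t ^+ 2) = s.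
      by rewrite /Rintegral gaussian_rescale.
    rewrite -[leRHS]sE; apply: Rint_le => [||t]; last exact: expR_ge1Dx.
    - by apply: integrableRD; [exact: integrableR_cst|exact: integrableRZ].
    - apply/integrableP; split.
        apply/measurable_EFinP; apply: measurableT_comp => //.
        by apply: measurable_funM => //; exact: measurable_funX.
      under eq_integral do rewrite /= ger0_norm ?expR_ge0//.
      by rewrite gaussian_rescale// ltry.
  have := cm; rewrite -subr_ge0 -(@pmulr_rge0 _ (2 * s ^+ 2 * sigma ^+ 2)).
    suff -> : 2 * s ^+ 2 * sigma ^+ 2 * (s - (1 + c * m)) =
      (1 - s) * ((1 + s) * m - 2 * s ^+ 2 * sigma ^+ 2) by [].
    by rewrite /c; field; rewrite sigma_neq0 gt_eqF.
  by rewrite !mulr_gt0 ?exprn_gt0.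
pose r := m / sigma ^+ 2.
have mE : m = r * sigma ^+ 2 by rewrite /r divfK// expf_neq0.
have r0 : 0 <= r.
  by rewrite divr_ge0 ?sqr_ge0// Rintegral_ge0// => t _; rewrite sqr_ge0.
have s2 : 0 < sigma ^+ 2 by rewrite exprn_gt0.
suff r1 : r = 1 by rewrite mE r1 mul1r.
(* Halfway between [1] and [r] the expression in [key] is minus a square, which forces [r = 1]. *)
have := key ((1 + r) / 2); rewrite divr_gt0 ?ltr_wpDr// mE => /(_ isT).
have -> : (1 - (1 + r) / 2) * ((1 + (1 + r) / 2) * (r * sigma ^+ 2) -
    2 * ((1 + r) / 2) ^+ 2 * sigma ^+ 2) = - ((1 - r) / 2) ^+ 2 * sigma ^+ 2.
  by field.
rewrite pmulr_lge0// oppr_ge0.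
rewrite le_eqVlt ltNge sqr_ge0 orbF sqrf_eq0 mulf_eq0 invr_eq0 pnatr_eq0 orbF.
by rewrite subr_eq0 => /eqP.
Qed.
End gaussian_moments.

(** * Independence and polynomials in the noise *)

Section independence.
Context (R : realType) (d : measure_display) (T : measurableType d).
Context (P : probability T R) (n : nat) (eps : 'I_n -> {RV P >-> R}).
Hypothesis eps_indep : mutually_independent eps.

Let meps i : measurable_fun setT (eps i).
Proof. exact: measurable_funP. Qed.

Let mprod (f : 'I_n -> R -> R) (Q : pred 'I_n) :
  (forall i, measurable_fun setT (f i)) ->
  measurable_fun setT (fun t => \prod_(i | Q i) f i (eps i t)).
Proof.
move=> mf; under eq_fun do rewrite -big_filter.
by apply: measurable_prod => i _; exact: measurableT_comp.
Qed.

Lemma indep_indic (B : 'I_n -> set R) : (forall i, measurable (B i)) ->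
  (\int[P]_t (\prod_i \1_(B i) (eps i t))%:E =
   (\prod_i \int[P]_t (\1_(B i) (eps i t)))%:E)%E.
Proof.
move=> mB.
have mpre i : measurable (eps i @^-1` B i) by rewrite -(setTI (_ @^-1` _)); exact: meps.
have eB i : (\int[P]_t (\1_(B i) (eps i t)))%:E = P (eps i @^-1` B i).
  have := integral_indic P measurableT (mpre i); rewrite setIT => PE.
  by rewrite /Rintegral [X in fine X]PE fineK// fin_num_measure.
pose C := \bigcap_(i in [set: 'I_n]) (eps i @^-1` B i).
transitivity (\int[P]_t (\1_C t)%:E)%E.
  apply: eq_integral => t _; congr (_%:E); rewrite indicE.
  have [tC|tC] := boolP (t \in C).
    rewrite big1// => i _; rewrite indicE mem_set//.
    by move: tC; rewrite inE => /(_ i I).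
  have /existsNP[i] : ~ (forall i, B i (eps i t)).
    by move=> H; move/negP: tC; apply; rewrite inE => i _; exact: H.
  by move=> NB; rewrite (bigD1 i)//= indicE memNset// mul0r.
have mC : measurable C by apply: fin_bigcap_measurable => // i _; exact: mpre.
have := integral_indic P measurableT mC; rewrite setIT => ->.
transitivity (\prod_i P (eps i @^-1` B i))%E; first exact: eps_indep.
rewrite -prodEFin; apply: eq_bigr => i _; exact/esym/eB.
Qed.

(* The indicators are replaced by arbitrary functions one coordinate at a
   time; in each step the product over the other coordinates is a density. *)
Lemma indep_prod_ge0 (g : 'I_n -> R -> R) :
  (forall i, measurable_fun setT (g i)) -> (forall i x, 0 <= g i x) ->
  (forall i, integrableR P (g i \o eps i)) ->
  (\int[P]_t (\prod_i g i (eps i t))%:E =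
   (\prod_i \int[P]_t (g i (eps i t)))%:E)%E.
Proof.
suff step k : forall (g : 'I_n -> R -> R) (B : 'I_n -> set R),
    (forall i, measurable (B i)) ->
    (forall i, measurable_fun setT (g i)) -> (forall i x, 0 <= g i x) ->
    (forall i, integrableR P (g i \o eps i)) ->
    (forall i : 'I_n, (k <= i)%N -> g i = \1_(B i)) ->
    (\int[P]_t (\prod_i g i (eps i t))%:E =
     (\prod_i \int[P]_t (g i (eps i t)))%:E)%E.
  move=> mg g0 ig; apply: (step n g (fun=> set0)) => // i.
  by rewrite leqNgt ltn_ord.
elim: k => [|k IH] {}g B mB mg g0 ig gB.
  have -> : g = fun i => \1_(B i) by apply/funext => i; rewrite gB.
  exact: indep_indic.
have [kn|kn] := ltnP k n; last first.
  by apply: (IH g B) => // i ki; move: (ltn_ord i); rewrite ltnNge (leq_trans kn ki).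
pose j := Ordinal kn.
pose c := \prod_(i | i != j) \int[P]_t (g i (eps i t)).
have c0 : 0 <= c.
  by apply: prodr_ge0 => i _; apply: Rintegral_ge0 => t _; exact: g0.
pose Y t := \prod_(i | i != j) g i (eps i t).
have mY : measurable_fun setT Y by exact: mprod.
have Y0 t : 0 <= Y t by apply: prodr_ge0.
(* Placing the indicator of [A] at coordinate [j] gives a family covered by the induction
   hypothesis; this identifies the image under [eps j] of the measure with density [Y]. *)
have YP A : measurable A ->
    (\int[P]_(t in eps j @^-1` A) (Y t)%:E = c%:E * distribution P (eps j) A)%E.
  move=> mA.
  have mpre : measurable (eps j @^-1` A) by rewrite -(setTI (_ @^-1` _)); exact: meps.
  pose g' i := if i == j then \1_A else g i.
  pose B' i := if i == j then A else B i.
  have prodg' : \prod_i \int[P]_t (g' i (eps i t)) = c * fine (P (eps j @^-1` A)).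
    rewrite (bigD1 j)//= mulrC; congr (_ * _).
      by apply: eq_bigr => i /negPf ij; rewrite /g' ij.
    rewrite /g' eqxx /Rintegral; congr fine.
    by have := integral_indic P measurableT mpre; rewrite setIT.
  transitivity (\int[P]_t (\prod_i g' i (eps i t))%:E)%E.
    rewrite integral_mkcond; apply: eq_integral => t _.
    rewrite patchE (bigD1 j)//= /g' eqxx.
    rewrite (eq_bigr (fun i => g i (eps i t))); last by move=> i /negPf ->.
    have [tA|tA] := boolP (t \in eps j @^-1` A).
      by rewrite indicE (_ : _ \in A) ?mul1r//; move: tA; rewrite !inE.
    rewrite indicE (_ : _ \in A = false) ?mul0r//; apply/negP; rewrite inE => At.
    by move/negP: tA; apply; rewrite inE.
  rewrite (IH g' B'); first by rewrite prodg' EFinM fineK// fin_num_measure.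
  - by move=> i; rewrite /B'; case: ifP.
  - by move=> i; rewrite /g'; case: ifP => // _; exact: measurable_indic.
  - by move=> i x; rewrite /g'; case: ifP => // _; rewrite indicE ler0n.
  - move=> i; rewrite /g'; case: ifP => [/eqP ->|_]; last exact: ig.
    have : integrableR P (\1_(eps j @^-1` A)) by apply: integrable_indic.
    by [].
  - move=> i ki; rewrite /g' /B'; case: ifPn => // ij; apply: gB.
    by rewrite ltn_neqAle ki andbT eq_sym.
have prodg : \prod_i \int[P]_t (g i (eps i t)) = c * \int[P]_t (g j (eps j t)).
  by rewrite (bigD1 j)//= mulrC.
rewrite prodg EFinM.
transitivity (\int[P]_t (g j (eps j t) * Y t)%:E)%E.
  by apply: eq_integral => t _; rewrite (bigD1 j).
have := @ge0_integral_density _ _ _ _ R P (distribution P (eps j)) (eps j) Y c.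
move=> /(_ (@meps j) mY Y0 YP (g j) (mg j) (g0 j)) ->; congr (_ * _)%E.
rewrite ge0_integral_distribution//=; last 2 first.
- exact/measurable_EFinP.
- by move=> x; rewrite lee_fin.
by rewrite fineK//; exact: integrable_fin_num (ig j).
Qed.

(** Signed factors are split into positive and negative parts one coordinate at a time, the product
    being linear in each factor. The induction parameter [k] says that the factors from index [k] on
    are already nonnegative. *)
Lemma indep_prod (f : 'I_n -> R -> R) :
  (forall i, measurable_fun setT (f i)) -> (forall i, integrableR P (f i \o eps i)) ->
  integrableR P (fun t => \prod_i f i (eps i t)) /\
  \int[P]_t (\prod_i f i (eps i t)) = \prod_i \int[P]_t (f i (eps i t)).
Proof.
suff step k : forall f : 'I_n -> R -> R,
    (forall i, measurable_fun setT (f i)) -> (forall i, integrableR P (f i \o eps i)) ->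
    (forall (i : 'I_n) x, (k <= i)%N -> 0 <= f i x) ->
    integrableR P (fun t => \prod_i f i (eps i t)) /\
    \int[P]_t (\prod_i f i (eps i t)) = \prod_i \int[P]_t (f i (eps i t)).
  by move=> mf jf; apply: (step n) => // i x; rewrite leqNgt ltn_ord.
elim: k => [|k IH] {}f mf jf f0.
  have f0' i x : 0 <= f i x by exact: f0.
  have E := indep_prod_ge0 mf f0' jf; split; last by rewrite /Rintegral E.
  apply/integrableP; split; first exact/measurable_EFinP/mprod.
  under eq_integral do rewrite /= ger0_norm ?prodr_ge0//.
  by rewrite E ltry.
have [kn|kn] := ltnP k n; last first.
  by apply: IH => // i x ki; move: (ltn_ord i); rewrite ltnNge (leq_trans kn ki).
pose j := Ordinal kn.
pose upd h i := if i == j then h else f i.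
have updP h : measurable_fun setT h -> integrableR P (h \o eps j) -> (forall x, 0 <= h x) ->
    integrableR P (fun t => \prod_i upd h i (eps i t)) /\
    \int[P]_t (\prod_i upd h i (eps i t)) =
      (\int[P]_t h (eps j t)) * \prod_(i | i != j) \int[P]_t (f i (eps i t)).
  move=> mh ih h0.
  have [|||ih' eh] := IH (upd h).
  - by move=> i; rewrite /upd; case: ifP.
  - by move=> i; rewrite /upd; case: ifP => [/eqP ->|].
  - move=> i x ki; rewrite /upd; case: ifPn => // ij; apply: f0.
    by rewrite ltn_neqAle ki andbT eq_sym.
  split=> //; rewrite eh (bigD1 j)//= /upd eqxx; congr (_ * _).
  by apply: eq_bigr => i /negPf ->.
have jp : integrableR P ((f j)^\+ \o eps j) by exact: integrable_funrpos (jf j).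
have jn : integrableR P ((f j)^\- \o eps j) by exact: integrable_funrneg (jf j).
have [ip ep] := updP _ (measurable_funrpos (mf j)) jp (@funrpos_ge0 _ _ (f j)).
have [im em] := updP _ (measurable_funrneg (mf j)) jn (@funrneg_ge0 _ _ (f j)).
have fE t : \prod_i f i (eps i t) = \prod_i upd (f j)^\+ i (eps i t)
    + (-1) * \prod_i upd (f j)^\- i (eps i t).
  rewrite (bigD1 j)//= [in RHS](bigD1 j)//= [X in _ + _ * X](bigD1 j)//= /upd eqxx.
  under [X in _ = _ * X + _]eq_bigr => i /negPf -> do over.
  under [X in _ = _ + _ * (_ * X)]eq_bigr => i /negPf -> do over.
  by rewrite mulN1r -mulrBl -{1}(funrposBneg (f j)).
have imN := integrableRZ (-1) im.
split; first by under eq_fun do rewrite fE; exact: integrableRD.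
under eq_Rintegral do rewrite fE.
rewrite RintD// RintZ// ep em mulN1r -mulrBl [RHS](bigD1 j)//=; congr (_ * _).
rewrite -mulN1r -RintZ// -RintD//; last exact: integrableRZ.
by apply: eq_Rintegral => t _; rewrite mulN1r -[in RHS](funrposBneg (f j)).
Qed.
End independence.

Lemma sqr_le_sqr (R : realDomainType) (x y : R) : 0 <= x -> x <= y -> x ^+ 2 <= y ^+ 2.
Proof. by move=> x0 xy; rewrite ler_sqr ?nnegrE// (le_trans x0). Qed.

(** [kappa] is fixed before the probability space, as an absolute constant requires. The orders 4
    and 8 are those met in the fourth power of a quadratic polynomial in one coordinate. *)
Lemma gaussian_moment_48 (R : realType) : exists2 kappa : R, 1 <= kappa &
  forall (d : measure_display) (T : measurableType d) (P : probability T R)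
    (Z : {RV P >-> R}) (sigma : R), 0 < sigma ->
    (forall B, measurable B -> distribution P Z B = normal_prob 0 sigma B) ->
    forall k, (k == 4%N) || (k == 8%N) ->
    \int[P]_x (Z x ^+ k) <= kappa * sigma ^+ k.
Proof.
pose c k : R := 2 * expR 2^-1 * k`!%:R.
have c0 k : 0 <= c k by rewrite mulr_ge0 ?ler0n// mulr_ge0// expR_ge0.
exists (1 + (c 4%N + c 8%N)); first by rewrite lerDl addr_ge0 ?c0.
move=> d T P Z sigma sigma0 law k k48.
have jk := gaussian_integrableX sigma0 law k.
apply: (@le_trans _ _ (c k * sigma ^+ k)).
  apply: le_trans (gaussian_moment_le sigma0 law k).
  apply: Rint_le => // [|x]; last by rewrite -normrX ler_norm.
  by under eq_fun do rewrite -normrX; exact/integrableR_norm.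
rewrite ler_pM2r ?exprn_gt0//; have := c0 4%N; have := c0 8%N.
by case/orP: k48 => /eqP ->; move: (c 4%N) (c 8%N) => u v; lra.
Qed.

(** * Polynomials in the noise and the fourth moment of a chaos *)

Section noise_polynomials.
Context (R : realType) (d : measure_display) (T : measurableType d).
Context (P : probability T R) (n : nat) (eps : 'I_n -> {RV P >-> R}).
Context (sigma : R).
Hypotheses (sigma0 : 0 < sigma) (noise : gaussian_noise sigma eps).

Let law i : forall B, measurable B ->
  distribution P (eps i) B = normal_prob 0 sigma B.
Proof. exact: noise.2. Qed.

Definition monomial (a : 'I_n -> nat) (t : T) : R := \prod_i eps i t ^+ a i.

Lemma monomial_moment a : integrableR P (monomial a) /\
  \int[P]_t monomial a t = \prod_i \int[P]_t (eps i t ^+ a i).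
Proof.
have := @indep_prod _ _ _ P n eps noise.1 (fun i x => x ^+ a i); apply.
- by move=> i; exact: exprn_measurable.
- by move=> i; exact: (gaussian_integrableX sigma0 (@law i)).
Qed.

(* Polynomials in the noise coordinates of index less than [j]. *)
Inductive poly_below (j : nat) : (T -> R) -> Prop :=
| poly_below0 : poly_below j (fun=> 0)
| poly_belowD c a f : (forall i : 'I_n, (j <= i)%N -> a i = 0%N) ->
    poly_below j f -> poly_below j (fun t => c * monomial a t + f t).

Lemma poly_int j f : poly_below j f -> integrableR P f.
Proof.
elim=> [|c a {}f _ _ IH]; first exact: integrableR_cst.
by apply: integrableRD => //; apply: integrableRZ; have [] := monomial_moment a.
Qed.

(** [poly_below i] plays the role of measurability with respect to the past of coordinate [i], and
    this factorization that of conditional expectation. By linearity it reduces to monomials, where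
    the exponent at [i] is raised from [0] to [k]. *)
Lemma poly_indep (i : 'I_n) f k : poly_below i f ->
  \int[P]_t (f t * eps i t ^+ k) = \int[P]_t f t * \int[P]_t (eps i t ^+ k).
Proof.
move=> pf; suff [] : integrableR P (fun t => f t * eps i t ^+ k) /\
  \int[P]_t (f t * eps i t ^+ k) = \int[P]_t f t * \int[P]_t (eps i t ^+ k) by [].
elim: pf => [|c a {}f a0 pf [jf IH]].
  split; first by under eq_fun do rewrite mul0r; exact: integrableR_cst.
  by under eq_Rintegral do rewrite mul0r; rewrite !Rint_cst mul0r.
pose b i' := if i' == i then k else a i'.
have [ja ea] := monomial_moment a; have [jb eb] := monomial_moment b.
have ab t : monomial a t * eps i t ^+ k = monomial b t.
  rewrite /monomial (bigD1 i)//= a0// expr0 mul1r [RHS](bigD1 i)//= /b eqxx mulrC.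
  by congr (_ * _); apply: eq_bigr => i' /negPf ->.
have fE t : (c * monomial a t + f t) * eps i t ^+ k =
    c * monomial b t + f t * eps i t ^+ k by rewrite mulrDl -mulrA ab.
split; first by under eq_fun do rewrite fE; apply: integrableRD => //; exact: integrableRZ.
under eq_Rintegral do rewrite fE.
have cjb := integrableRZ c jb; have cja := integrableRZ c ja.
rewrite RintD// RintZ// IH RintD//; last exact: poly_int pf.
rewrite RintZ// mulrDl; congr (_ + _); rewrite -mulrA; congr (_ * _).
rewrite ea eb (bigD1 i)//= [in RHS](bigD1 i)//= /b eqxx a0//.
under [X in _ = X * _ * _]eq_Rintegral do rewrite expr0.
rewrite Rint_cst mul1r mulrC; congr (_ * _).
by apply: eq_bigr => i' /negPf ->.
Qed.

Lemma poly_add j f g : poly_below j f -> poly_below j g ->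
  poly_below j (fun t => f t + g t).
Proof.
move=> pf pg; elim: pf => [|c a {}f a0 _ IH].
  by have -> : (fun t => 0 + g t) = g by apply/funext => t; rewrite add0r.
have -> : (fun t => c * monomial a t + f t + g t) =
    (fun t => c * monomial a t + (f t + g t)).
  by apply/funext => t; rewrite addrA.
exact: poly_belowD.
Qed.

Lemma poly_scale j c f : poly_below j f -> poly_below j (fun t => c * f t).
Proof.
elim=> [|c' a {}f a0 _ IH].
  have -> : (fun=> c * 0) = (fun=> 0) :> (T -> R) by apply/funext => t; rewrite mulr0.
  exact: poly_below0.
have -> : (fun t => c * (c' * monomial a t + f t)) =
    (fun t => (c * c') * monomial a t + c * f t).
  by apply/funext => t; rewrite mulrDr mulrA.
exact: poly_belowD.
Qed.

Lemma poly_monomial j a : (forall i : 'I_n, (j <= i)%N -> a i = 0%N) ->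
  poly_below j (monomial a).
Proof.
move=> a0; have -> : monomial a = (fun t => 1 * monomial a t + 0).
  by apply/funext => t; rewrite mul1r addr0.
by apply: poly_belowD => //; exact: poly_below0.
Qed.

Lemma poly_cst j c : poly_below j (fun=> c).
Proof.
have -> : (fun=> c) = (fun t => c * monomial (fun=> 0%N) t).
  by apply/funext => t; rewrite /monomial big1 ?mulr1// => i _; rewrite expr0.
by apply: poly_scale; exact: poly_monomial.
Qed.

Lemma poly_eps j (i : 'I_n) : (i < j)%N -> poly_below j (eps i).
Proof.
move=> ij; have -> : (eps i : T -> R) = monomial (fun i' => i' == i).
  apply/funext => t; rewrite /monomial (bigD1 i)//= eqxx expr1 big1 ?mulr1//.
  by move=> i' /negPf ->; rewrite expr0.
apply: poly_monomial => i' ji'; case: eqP => // ii'.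
by move: ji'; rewrite ii' leqNgt ij.
Qed.

Lemma poly_mul j f g : poly_below j f -> poly_below j g ->
  poly_below j (fun t => f t * g t).
Proof.
move=> pf pg; elim: pf => [|c a {}f a0 _ IH].
  have -> : (fun t => 0 * g t) = (fun=> 0) by apply/funext => t; rewrite mul0r.
  exact: poly_below0.
have -> : (fun t => (c * monomial a t + f t) * g t) =
    (fun t => c * (monomial a t * g t) + f t * g t).
  by apply/funext => t; rewrite mulrDl mulrA.
apply: poly_add => //; apply: poly_scale.
elim: pg => [|c' b {IH}g b0 _ IH].
  have -> : (fun t => monomial a t * 0) = (fun=> 0) by apply/funext => t; rewrite mulr0.
  exact: poly_below0.
have -> : (fun t => monomial a t * (c' * monomial b t + g t)) =
    (fun t => c' * monomial (fun i => (a i + b i)%N) t + monomial a t * g t).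
  apply/funext => t; rewrite mulrDr mulrCA; congr (_ * _ + _).
  by rewrite /monomial -big_split/=; apply: eq_bigr => i _; rewrite exprD.
by apply: poly_belowD => // i ji; rewrite a0 ?b0.
Qed.

Lemma poly_exp j f k : poly_below j f -> poly_below j (fun t => f t ^+ k).
Proof.
move=> pf; elim: k => [|k IH]; first exact: poly_cst.
by under eq_fun do rewrite exprS; exact: poly_mul.
Qed.

Lemma poly_sum j (I : finType) (Q : pred I) (f : I -> T -> R) :
  (forall i, Q i -> poly_below j (f i)) ->
  poly_below j (fun t => \sum_(i | Q i) f i t).
Proof.
move=> pf; suff H (s : seq I) : poly_below j (fun t => \sum_(i <- s | Q i) f i t).
  exact: H.
elim: s => [|i s IH]; first by under eq_fun do rewrite big_nil; exact: poly_below0.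
have [Qi|/negPf Qi] := boolP (Q i); under eq_fun do rewrite big_cons Qi; last by [].
by apply: poly_add => //; exact: pf.
Qed.

Lemma poly_widen j j' f : (j <= j')%N -> poly_below j f -> poly_below j' f.
Proof.
move=> jj'; elim=> [|c a {}f a0 _ IH]; first exact: poly_below0.
by apply: poly_belowD => // i ji; rewrite a0// (leq_trans jj').
Qed.

(** The quadratic [x |-> E (x f + g)^2] is nonnegative; evaluating it at its minimizer [- b / a]
    gives the claim when [a > 0]. *)
Lemma poly_cauchy_schwarz j f g : poly_below j f -> poly_below j g ->
  (\int[P]_t (f t * g t)) ^+ 2 <= (\int[P]_t (f t ^+ 2)) * \int[P]_t (g t ^+ 2).
Proof.
move=> pf pg; set a := \int[P]_t (f t ^+ 2); set c := \int[P]_t (g t ^+ 2).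
set b := \int[P]_t (f t * g t).
have jf := poly_int (poly_exp 2 pf); have jg := poly_int (poly_exp 2 pg).
have jfg := poly_int (poly_mul pf pg).
have quad x : 0 <= x ^+ 2 * a + 2 * x * b + c.
  have -> : x ^+ 2 * a + 2 * x * b + c =
      \int[P]_t (x ^+ 2 * f t ^+ 2 + 2 * x * (f t * g t) + g t ^+ 2).
    have j1 := integrableRZ (x ^+ 2) jf; have j2 := integrableRZ (2 * x) jfg.
    by rewrite RintD ?RintD ?RintZ//; exact: integrableRD.
  apply: Rintegral_ge0 => t _; have := sqr_ge0 (x * f t + g t).
  by rewrite sqrrD exprMn; lra.
have a0 : 0 <= a by apply: Rintegral_ge0 => t _; rewrite sqr_ge0.
move: a0; rewrite le_eqVlt => /predU1P[a0|a0].
  have [->|b0] := eqVneq b 0; first by rewrite expr0n -a0 mul0r.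
  (* With [a = 0] the quadratic is affine, and at this point it equals [-1]. *)
  have := quad (- (c + 1) / (2 * b)); rewrite -a0 mulr0 add0r.
  have -> : 2 * (- (c + 1) / (2 * b)) * b = - (c + 1) by field.
  lra.
have := quad (- b / a).
have -> : (- b / a) ^+ 2 * a + 2 * (- b / a) * b + c = (a * c - b ^+ 2) / a.
  by field; rewrite gt_eqF.
by rewrite pmulr_lge0 ?invr_gt0// subr_ge0.
Qed.

Lemma poly_le j f g : poly_below j f -> poly_below j g ->
  (forall t, f t <= g t) -> \int[P]_t f t <= \int[P]_t g t.
Proof. by move=> /poly_int jf /poly_int jg; exact: Rint_le. Qed.

(* [E (S + D)^4 <= E S^4 + 8 E S^2 D^2 + 3 E D^4 <= (q + 4 t)^2] as soon as
   [E S^3 D = 0], [E S^4 <= q^2] and [E D^4 <= t^2]. *)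
Lemma martingale_fourth_moment (D : 'I_n -> T -> R) (t : 'I_n -> R) (j : nat) :
  (forall i : 'I_n, poly_below i.+1 (D i)) -> (forall i, 0 <= t i) ->
  (forall (i : 'I_n) f, poly_below i f -> \int[P]_x (f x * D i x) = 0) ->
  (forall i, \int[P]_x (D i x ^+ 4) <= t i ^+ 2) ->
  \int[P]_x ((\sum_(i < n | (i < j)%N) D i x) ^+ 4)
    <= (4 * \sum_(i < n | (i < j)%N) t i) ^+ 2.
Proof.
move=> pD t0 cD D4; elim: j => [|j IH].
  under eq_Rintegral do rewrite big_pred0//.
  by rewrite big_pred0// mulr0 !expr0n Rint_cst.
have [nj|jn] := leqP n j.
  have sameQ (V : nmodType) (F : 'I_n -> V) :
      \sum_(i < n | (i < j.+1)%N) F i = \sum_(i < n | (i < j)%N) F i.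
    apply: eq_bigl => i; have ij := leq_trans (ltn_ord i) nj.
    by rewrite ij ltnS ltnW.
  by under eq_Rintegral do rewrite sameQ; rewrite sameQ.
pose i0 := Ordinal jn.
have split_sum (V : nmodType) (F : 'I_n -> V) :
    \sum_(i < n | (i < j.+1)%N) F i = \sum_(i < n | (i < j)%N) F i + F i0.
  rewrite (bigD1 i0)//= addrC; congr (_ + _); apply: eq_bigl => i.
  by rewrite ltnS ltn_neqAle andbC.
under eq_Rintegral do rewrite split_sum.
rewrite split_sum.
set q := \sum_(i < n | (i < j)%N) t i in IH *.
have q0 : 0 <= q by apply: sumr_ge0.
pose S x := \sum_(i < n | (i < j)%N) D i x.
have pS : poly_below j S.
  by apply: poly_sum => i ij; exact: poly_widen (pD i).
have pS' : poly_below j.+1 S by exact: poly_widen pS.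
have pDj := pD i0; rewrite /= in pDj.
have cross : \int[P]_x (S x ^+ 2 * D i0 x ^+ 2) <= 4 * q * t i0.
  have := poly_cauchy_schwarz (poly_exp 2 pS') (poly_exp 2 pDj).
  under [X in _ <= X * _ -> _]eq_Rintegral do rewrite -exprM.
  under [X in _ <= _ * X -> _]eq_Rintegral do rewrite -exprM.
  move=> CS; rewrite -ler_sqr ?nnegrE ?mulr_ge0//; last first.
    by apply: Rintegral_ge0 => x _; rewrite mulr_ge0 ?sqr_ge0.
  apply: (le_trans CS); rewrite exprMn; apply: ler_pM => //.
  - by apply: Rintegral_ge0 => x _; rewrite exprn_even_ge0.
  - by apply: Rintegral_ge0 => x _; rewrite exprn_even_ge0.
pose f x := S x ^+ 4 + (4 * (S x ^+ 3 * D i0 x) + (8 * (S x ^+ 2 * D i0 x ^+ 2)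
  + 3 * D i0 x ^+ 4)).
have p3 : poly_below j.+1 (fun x => S x ^+ 3 * D i0 x) by apply: poly_mul => //; exact: poly_exp.
have p2 : poly_below j.+1 (fun x => S x ^+ 2 * D i0 x ^+ 2) by apply: poly_mul; exact: poly_exp.
have pS4 := poly_exp 4 pS'; have pD4 := poly_exp 4 pDj.
have q3 := poly_scale 4 p3; have q2 := poly_scale 8 p2; have q4 := poly_scale 3 pD4.
apply: (@le_trans _ _ (\int[P]_x f x)).
  apply: poly_le.
  - exact: poly_exp (poly_add pS' pDj).
  - exact: poly_add pS4 (poly_add q3 (poly_add q2 q4)).
  move=> x; rewrite /f -/(S x); move: (S x) (D i0 x) => a b.
  (* The mixed term [4 a b^3], which has no sign, is bounded by [2 a^2 b^2 + 2 b^4]. *)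
  have := sqr_ge0 (a * b - b ^+ 2); nra.
have [jS4 j3 j2 j4] : [/\ integrableR P (fun x => S x ^+ 4),
  integrableR P (fun x => S x ^+ 3 * D i0 x),
  integrableR P (fun x => S x ^+ 2 * D i0 x ^+ 2) & integrableR P (fun x => D i0 x ^+ 4)].
  by split; apply: (@poly_int j.+1).
have [k3 k2 k4] : [/\ integrableR P (fun x => 4 * (S x ^+ 3 * D i0 x)),
  integrableR P (fun x => 8 * (S x ^+ 2 * D i0 x ^+ 2)) & integrableR P (fun x => 3 * D i0 x ^+ 4)].
  by split; apply: (@poly_int j.+1).
have k24 := integrableRD k2 k4; have k324 := integrableRD k3 k24.
rewrite /f RintD// RintD// RintD// !RintZ// cD; last exact: poly_exp.
have := D4 i0; have := t0 i0; move: IH cross.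
rewrite -/(S _) mulr0 add0r; move: (\int[P]_x _) (\int[P]_x _) (\int[P]_x _) => A B C.
by move: (t i0) => u; nra.
Qed.

Let int_eps i k : integrableR P (fun x => eps i x ^+ k).
Proof. exact: (gaussian_integrableX sigma0 (@law i)). Qed.

Let mean_eps i : \int[P]_x eps i x = 0.
Proof. exact: (gaussian_mean sigma0 (@law i)). Qed.

Let var_eps i : \int[P]_x (eps i x ^+ 2) = sigma ^+ 2.
Proof. exact: (gaussian_variance sigma0 (@law i)). Qed.

Variable kappa : R.
Hypothesis kappa1 : 1 <= kappa.
Hypothesis moment_eps : forall i k, (k == 4%N) || (k == 8%N) ->
  \int[P]_x (eps i x ^+ k) <= kappa * sigma ^+ k.

Let linear_fourth_moment (j : nat) (c : 'I_n -> R) :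
  \int[P]_x ((\sum_(i < n | (i < j)%N) c i * eps i x) ^+ 4)
    <= (4 * (kappa * sigma ^+ 2 * \sum_(i < n | (i < j)%N) c i ^+ 2)) ^+ 2.
Proof.
have k0 := lt_le_trans ltr01 kappa1.
rewrite mulr_sumr; apply: (@martingale_fourth_moment (fun i x => c i * eps i x)
  (fun i => kappa * sigma ^+ 2 * c i ^+ 2)) => [i|i|i f pf|i].
- by apply: poly_scale; exact: poly_eps.
- by rewrite mulr_ge0 ?sqr_ge0// mulr_ge0 ?sqr_ge0// ltW.
- have := poly_indep 1 pf; rewrite /= => fe.
  under eq_Rintegral do rewrite mulrCA.
  rewrite RintZ; last by apply: (@poly_int i.+1); apply: poly_mul;
    [exact: poly_widen pf|exact: poly_eps].
  by rewrite [X in _ * X]fe mean_eps !mulr0.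
- under eq_Rintegral do rewrite exprMn.
  rewrite RintZ; last exact: int_eps.
  apply: (@le_trans _ _ (c i ^+ 4 * (kappa * sigma ^+ 4))).
    by rewrite ler_wpM2l ?exprn_even_ge0// moment_eps.
  have -> : (kappa * sigma ^+ 2 * c i ^+ 2) ^+ 2 = c i ^+ 4 * (kappa * (kappa * sigma ^+ 4)).
    by ring.
  rewrite ler_wpM2l ?exprn_even_ge0// ler_pMl//.
  by rewrite mulr_gt0 ?exprn_gt0.
Qed.

Definition chaos (G : 'M[R]_n) (h : 'cV[R]_n) (v : 'cV[R]_n) : R :=
  dotv v (G *m v) - sigma ^+ 2 * \tr G + dotv v h.

Let sum_lower (F : 'I_n -> 'I_n -> R) : \sum_i \sum_k F i k =
  \sum_(i < n) (F i i + \sum_(k < n | (k < i)%N) (F i k + F k i)).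
Proof.
have split3 (i : 'I_n) : \sum_k F i k = F i i +
    (\sum_(k < n | (k < i)%N) F i k + \sum_(k < n | (i < k)%N) F i k).
  rewrite (bigD1 i)//= (bigID (fun k : 'I_n => (k < i)%N))/=.
  congr (_ + (_ + _)); apply: eq_bigl => k.
    by rewrite ltn_neqAle andbA andbb.
  by rewrite -leqNgt [RHS]ltn_neqAle eq_sym.
under eq_bigr do rewrite split3.
under [RHS]eq_bigr do rewrite big_split/=.
rewrite !big_split/=; congr (_ + (_ + _)).
by rewrite (exchange_big_dep predT).
Qed.

(** Martingale decomposition: the summand at [i] is a centered square plus [v_i] times a function of
    the earlier coordinates. Both [G i k] and [G k i] appear because [G] is not assumed
    symmetric. *)
Let chaos_split (G : 'M[R]_n) (h v : 'cV[R]_n) : chaos G h v =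
  \sum_(i < n) (G i i * (v i 0 ^+ 2 - sigma ^+ 2) +
    v i 0 * (h i 0 + \sum_(k < n | (k < i)%N) (G i k + G k i) * v k 0)).
Proof.
rewrite /chaos !dotvE /mxtrace.
have -> : \sum_i v i 0 * (G *m v) i 0 = \sum_i \sum_k v i 0 * (G i k * v k 0).
  by apply: eq_bigr => i _; rewrite mxE mulr_sumr.
rewrite sum_lower mulr_sumr -sumrB -big_split/=; apply: eq_bigr => i _.
rewrite [v i 0 * (h i 0 + _)]mulrDr mulr_sumr.
under eq_bigr => k _.
  have -> : v i 0 * (G i k * v k 0) + v k 0 * (G k i * v i 0) =
    v i 0 * ((G i k + G k i) * v k 0) by ring.
  over.
by move: (\sum_(k < n | _) _) => A; ring.
Qed.

Let noise_vec (x : T) : 'cV[R]_n := \col_i eps i x.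

Lemma chaos_poly (G : 'M[R]_n) (h : 'cV[R]_n) :
  poly_below n (fun x => chaos G h (noise_vec x)).
Proof.
have pe i : poly_below n (fun x => noise_vec x i 0).
  by under eq_fun do rewrite mxE; exact: poly_eps.
under eq_fun do rewrite chaos_split.
apply: poly_sum => i _; apply: poly_add; first apply: poly_scale.
  by apply: poly_add; [exact: poly_exp|exact: poly_cst].
apply: poly_mul => //; apply: poly_add; first exact: poly_cst.
by apply: poly_sum => k _; exact: poly_scale.
Qed.

(** The bounds [t i] on the martingale differences add up to a multiple of the variance scale. The
    factor 256 is [4 * 2 * 32]: from [martingale_fourth_moment], from [(G i k + G k i)^2 <= 2 (G i
    k^2 + G k i^2)], and from [t]. *)
Lemma chaos_fourth_moment (G : 'M[R]_n) (h : 'cV[R]_n) :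
  \int[P]_x (chaos G h (noise_vec x) ^+ 4)
    <= (256 * kappa ^+ 2 * sigma ^+ 2 * (dotv h h + sigma ^+ 2 * frob2 G)) ^+ 2.
Proof.
have k0 := lt_le_trans ltr01 kappa1.
pose C (i : 'I_n) := \sum_(k < n | (k < i)%N) (G i k + G k i) ^+ 2.
pose L (i : 'I_n) x := \sum_(k < n | (k < i)%N) (G i k + G k i) * eps k x.
pose D i x := G i i * (eps i x ^+ 2 - sigma ^+ 2) + eps i x * (h i 0 + L i x).
pose t i := 32 * kappa ^+ 2 * sigma ^+ 2 *
  (sigma ^+ 2 * G i i ^+ 2 + h i 0 ^+ 2 + sigma ^+ 2 * C i).
have C0 i : 0 <= C i by apply: sumr_ge0 => k _; rewrite sqr_ge0.
have t0 i : 0 <= t i.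
  rewrite /t; apply: mulr_ge0; first by rewrite mulr_ge0 ?sqr_ge0// mulr_ge0 ?sqr_ge0.
  by rewrite !addr_ge0 ?sqr_ge0// mulr_ge0 ?sqr_ge0.
have sumE x : chaos G h (noise_vec x) = \sum_(i < n | (i < n)%N) D i x.
  rewrite chaos_split; apply: eq_big => [i|i _]; first by rewrite ltn_ord.
  by rewrite /D /L !mxE; under eq_bigr do rewrite mxE.
under eq_Rintegral do rewrite sumE.
apply: (@le_trans _ _ ((4 * \sum_(i < n | (i < n)%N) t i) ^+ 2)); last first.
  have t_sum : \sum_(i < n | (i < n)%N) t i <=
      64 * kappa ^+ 2 * sigma ^+ 2 * (dotv h h + sigma ^+ 2 * frob2 G).
    have frobE : frob2 G =
        \sum_(i < n) (G i i ^+ 2 + \sum_(k < n | (k < i)%N) (G i k ^+ 2 + G k i ^+ 2)).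
      by rewrite /frob2 sum_lower.
    rewrite frobE dotvE mulr_sumr -big_split/= mulr_sumr.
    rewrite (eq_bigl predT) => [|i]; last by rewrite ltn_ord.
    apply: ler_sum => i _; rewrite /t.
    have CE : C i <= 2 * \sum_(k < n | (k < i)%N) (G i k ^+ 2 + G k i ^+ 2).
      rewrite mulr_sumr; apply: ler_sum => k _.
      have := sqr_ge0 (G i k - G k i); rewrite sqrrB sqrrD; lra.
    have -> : 64 * kappa ^+ 2 * sigma ^+ 2 = 32 * kappa ^+ 2 * sigma ^+ 2 * 2 by ring.
    rewrite -[X in _ <= X]mulrA ler_wpM2l//.
      by rewrite mulr_ge0 ?sqr_ge0// mulr_ge0 ?sqr_ge0.
    have := ler_wpM2l (sqr_ge0 sigma) CE.
    have := mulr_ge0 (sqr_ge0 sigma) (sqr_ge0 (G i i)).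
    have := sqr_ge0 (h i 0).
    move: (\sum_(k < n | _) _) (C i) => A c; rewrite -expr2.
    move: (sigma ^+ 2) (G i i ^+ 2) (h i 0 ^+ 2) => s2 g2 h2; lra.
  have s0 : 0 <= \sum_(i < n | (i < n)%N) t i by apply: sumr_ge0.
  have rhsE : 256 * kappa ^+ 2 * sigma ^+ 2 * (dotv h h + sigma ^+ 2 * frob2 G) =
    4 * (64 * kappa ^+ 2 * sigma ^+ 2 * (dotv h h + sigma ^+ 2 * frob2 G)) by ring.
  have s4 : 0 <= 4 * \sum_(i < n | (i < n)%N) t i by rewrite mulr_ge0.
  have le4 : 4 * \sum_(i < n | (i < n)%N) t i <=
      256 * kappa ^+ 2 * sigma ^+ 2 * (dotv h h + sigma ^+ 2 * frob2 G).
    by rewrite rhsE ler_pM2l.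
  exact: sqr_le_sqr s4 le4.
have pL (i : 'I_n) : poly_below i (fun x => h i 0 + L i x).
  apply: poly_add; first exact: poly_cst.
  by apply: poly_sum => k ki; apply: poly_scale; exact: poly_eps.
apply: martingale_fourth_moment => // [i|i f pf|i].
- apply: poly_add.
    apply: poly_scale; apply: poly_add; last exact: poly_cst.
    by apply: poly_exp; exact: poly_eps.
  by apply: poly_mul; [exact: poly_eps|exact: poly_widen (pL i)].
(* The square part vanishes against [f] by the variance of [eps i], the product part by its mean, as
   [f * (h i 0 + L i)] involves only earlier coordinates. *)
- have fL := poly_mul pf (pL i).
  have e1 := poly_indep 1 fL; have e2 := poly_indep 2 pf.
  have pe : poly_below i.+1 (eps i) by exact: poly_eps.
  have pf' : poly_below i.+1 f by exact: poly_widen pf.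
  have pL' : poly_below i.+1 (fun x => h i 0 + L i x) by exact: poly_widen (pL i).
  have j1 : integrableR P (fun x => f x * eps i x ^+ 2).
    by apply: (@poly_int i.+1); exact: poly_mul pf' (poly_exp 2 pe).
  have j2 : integrableR P (fun x => f x * (h i 0 + L i x) * eps i x).
    by apply: (@poly_int i.+1); exact: poly_mul (poly_mul pf' pL') pe.
  have j3 := poly_int pf.
  have DE x : f x * D i x = G i i * (f x * eps i x ^+ 2) +
      (- G i i * sigma ^+ 2 * f x + f x * (h i 0 + L i x) * eps i x) by rewrite /D; ring.
  have k1 := integrableRZ (G i i) j1; have k3 := integrableRZ (- G i i * sigma ^+ 2) j3.
  under eq_Rintegral do rewrite DE.
  rewrite RintD//; last exact: integrableRD.
  rewrite RintD// !RintZ// e2 [X in _ + (_ + X)]e1 mean_eps var_eps; ring.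
- have pe : poly_below i.+1 (eps i) by exact: poly_eps.
  have pL' : poly_below i.+1 (fun x => h i 0 + L i x) by exact: poly_widen (pL i).
  have pD : poly_below i.+1 (D i).
    apply: poly_add; last exact: poly_mul.
    by apply: poly_scale; apply: poly_add; [exact: poly_exp|exact: poly_cst].
  have j8 := int_eps i 8.
  have jL4 := poly_int (poly_exp 4 (pL i)).
  have jLe := poly_int (poly_mul (poly_exp 4 pL') (poly_exp 4 pe)).
  have LM := linear_fourth_moment i (fun k => G i k + G k i).
  have pLL : poly_below i (L i) by apply: poly_sum => k ki; apply: poly_scale; exact: poly_eps.
  have jLL := poly_int (poly_exp 4 pLL).
  have pow4 (a b : R) : (a + b) ^+ 4 <= 8 * a ^+ 4 + 8 * b ^+ 4.
    have := sqr_ge0 (a - b); have := sqr_ge0 (a ^+ 2 - b ^+ 2).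
    have := sqr_ge0 ((a - b) ^+ 2); nra.
  have L4 : \int[P]_x ((h i 0 + L i x) ^+ 4) <=
      8 * h i 0 ^+ 4 + 8 * (4 * (kappa * sigma ^+ 2 * C i)) ^+ 2.
    have j1 := integrableRZ 8 jLL; have j0 := @integrableR_cst _ _ _ P (8 * h i 0 ^+ 4).
    apply: (@le_trans _ _ (\int[P]_x (8 * h i 0 ^+ 4 + 8 * L i x ^+ 4))).
      by apply: Rint_le => //; exact: integrableRD.
    by rewrite RintD// Rint_cst RintZ// lerD2l ler_pM2l.
  have k1 := integrableRZ (64 * G i i ^+ 4) j8.
  have k0c := @integrableR_cst _ _ _ P (64 * G i i ^+ 4 * sigma ^+ 8).
  have k2 := integrableRZ 8 jLe; have k02 := integrableRD k0c k2.
  apply: (@le_trans _ _ (\int[P]_x (64 * G i i ^+ 4 * eps i x ^+ 8 +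
     (64 * G i i ^+ 4 * sigma ^+ 8 + 8 * ((h i 0 + L i x) ^+ 4 * eps i x ^+ 4))))).
    apply: Rint_le => [||x]; [exact: poly_int (poly_exp 4 pD)|exact: integrableRD|].
    rewrite /D; move: (h i 0 + L i x) (eps i x) (G i i) => u e g.
    have := pow4 (g * (e ^+ 2 - sigma ^+ 2)) (e * u).
    have := pow4 (e ^+ 2) (- sigma ^+ 2).
    move/(ler_wpM2l (exprn_even_ge0 g (isT : ~~ odd 4))).
    rewrite !exprMn [(- _) ^+ 4]exprNn -!exprM; lra.
  rewrite RintD// RintD// Rint_cst !RintZ//.
  rewrite (poly_indep 4 (poly_exp 4 (pL i))).
  have e8 := @moment_eps i 8%N isT.
  have e4 := @moment_eps i 4%N isT.
  have e40 : 0 <= \int[P]_x (eps i x ^+ 4).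
    by apply: Rintegral_ge0 => x _; rewrite exprn_even_ge0.
  have L40 : 0 <= \int[P]_x ((h i 0 + L i x) ^+ 4).
    by apply: Rintegral_ge0 => x _; rewrite exprn_even_ge0.
  have prod4 := ler_pM L40 e40 L4 e4.
  have g8 := ler_wpM2l (exprn_even_ge0 (G i i) (isT : ~~ odd 4)) e8.
  apply: (@le_trans _ _ (64 * (G i i ^+ 4 * (kappa * sigma ^+ 8)) +
    (64 * G i i ^+ 4 * sigma ^+ 8 + 8 * ((8 * h i 0 ^+ 4 +
       8 * (4 * (kappa * sigma ^+ 2 * C i)) ^+ 2) * (kappa * sigma ^+ 4))))).
    clear e8 e4 e40 L40 L4 LM; move: g8 prod4.
    by move: (\int[P]_x _) (\int[P]_x _) (\int[P]_x _) => A B E; lra.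
  rewrite /t; have := C0 i; move: (C i) (G i i) (h i 0) => c g a c0.
  rewrite -subr_ge0.
  (* Every coefficient of the difference is nonnegative once [kappa >= 1]. The term in [c^2]
     dictates the factor [32] in [t], since [32^2 = 8 * 8 * 16]. *)
  have -> : (32 * kappa ^+ 2 * sigma ^+ 2 * (sigma ^+ 2 * g ^+ 2 + a ^+ 2 + sigma ^+ 2 * c)) ^+ 2 -
    (64 * (g ^+ 4 * (kappa * sigma ^+ 8)) + (64 * g ^+ 4 * sigma ^+ 8 +
      8 * ((8 * a ^+ 4 + 8 * (4 * (kappa * sigma ^+ 2 * c)) ^+ 2) * (kappa * sigma ^+ 4)))) =
    sigma ^+ 4 * (64 * (16 * kappa ^+ 4 - kappa - 1) * (sigma ^+ 4 * g ^+ 4)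
      + 64 * (16 * kappa ^+ 4 - kappa) * a ^+ 4
      + 1024 * (kappa ^+ 4 - kappa ^+ 3) * (sigma ^+ 4 * c ^+ 2)
      + 2048 * kappa ^+ 4 * (sigma ^+ 2 * g ^+ 2 * a ^+ 2
         + sigma ^+ 2 * g ^+ 2 * (sigma ^+ 2 * c) + a ^+ 2 * (sigma ^+ 2 * c))).
    by ring.
  have kk2 : 1 <= kappa ^+ 2 by rewrite exprn_ege1.
  have kk4 : kappa <= kappa ^+ 4 by rewrite -[leLHS]expr1 ler_weXn2l.
  have kk3 : kappa ^+ 3 <= kappa ^+ 4 by rewrite ler_weXn2l.
  have p1 : 0 <= 64 * (16 * kappa ^+ 4 - kappa - 1) by move: kappa1 kk4; lra.
  have p2 : 0 <= 64 * (16 * kappa ^+ 4 - kappa) by move: kappa1 kk4; lra.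
  have p3 : 0 <= 1024 * (kappa ^+ 4 - kappa ^+ 3) by move: kk3; lra.
  have p4 : 0 <= 2048 * kappa ^+ 4.
    by have := exprn_even_ge0 kappa (isT : ~~ odd 4); move: (kappa ^+ 4) => k4; lra.
  have e2 (x : R) : 0 <= x ^+ 2 := sqr_ge0 x.
  have e4' (x : R) : 0 <= x ^+ 4 := exprn_even_ge0 x (isT : ~~ odd 4).
  have sg := mulr_ge0 (e2 sigma) (e2 g); have sc := mulr_ge0 (e2 sigma) c0.
  apply: mulr_ge0; first exact: e4'.
  apply: addr_ge0; last first.
    apply: mulr_ge0 => //; apply: addr_ge0; last exact: mulr_ge0.
    by apply: addr_ge0; apply: mulr_ge0.
  apply: addr_ge0; last by apply: mulr_ge0 => //; apply: mulr_ge0.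
  apply: addr_ge0; last exact: mulr_ge0.
  by apply: mulr_ge0 => //; apply: mulr_ge0.
Qed.
End noise_polynomials.

(** * The oracle inequality *)

Lemma chaosB (R : realType) (n : nat) (sigma : R) (G G' : 'M[R]_n)
    (h h' v : 'cV[R]_n) :
  chaos sigma G h v - chaos sigma G' h' v = chaos sigma (G - G') (h - h') v.
Proof.
rewrite /chaos mulmxBl !dotvS linearB/=.
by move: (\tr G) (\tr G') => a b; ring.
Qed.

(** The degrees-of-freedom term centers [2 <e, B e>], and the mean of [- |B y|^2 / 2] splits off as
    minus half the penalty. *)
Lemma excess_chaosE (R : realType) (n p : nat) (X : 'M[R]_(n, p)) (K : 'M[R]_p)
    (sigma : R) (mu e : 'cV[R]_n) (l0 l : R) : posdefmx K ->
  let B := smoother X K l - smoother X K l0 in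
  2 * dotv e (B *m (mu + e)) - 2 * sigma ^+ 2 * \tr B
    - 2^-1 * dotv (B *m (mu + e)) (B *m (mu + e))
  = chaos sigma (quad_coef X K l0 l) (lin_coef X K mu l0 l) e
    - 2^-1 * penalty X K sigma mu l0 l.
Proof.
move=> K_pos B.
have Bs : B^T = B by rewrite linearB/= !smoother_sym.
rewrite /chaos /quad_coef /lin_coef /penalty -/B (frob2_sym Bs).
clearbody B.
rewrite !mulmxDr !mulmxBl -!scalemxAl !dotvS.
have sq u v : dotv (B *m u) (B *m v) = dotv u (B *m B *m v).
  by rewrite dotv_mulmxl Bs mulmxA.
have -> : \tr (2 *: B - 2^-1 *: (B *m B)) = 2 * \tr B - 2^-1 * \tr (B *m B).
  by rewrite linearB/= !linearZ.
rewrite !sq.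
have -> : dotv mu (B *m B *m e) = dotv e (B *m B *m mu).
  by rewrite -!sq dotvC.
move: (\tr B) (\tr (B *m B)) => a b; lra.
Qed.

(** With [a = (F + tau) / 2] one has [z <= a + z^4 / a^3], as [z > a] entails [z^3 >= a^3]; the
    factor 8 is [2^3]. *)
Lemma chaos_excess_le (R : realFieldType) (z F tau : R) : 0 <= F -> 0 < tau ->
  z - 2^-1 * F <= 2^-1 * tau + 8 * (z ^+ 4 / (F + tau) ^+ 3).
Proof.
move=> F0 tau0; set a := (F + tau) / 2.
have a0 : 0 < a by rewrite divr_gt0// ltr_wpDl.
have -> : 8 * (z ^+ 4 / (F + tau) ^+ 3) = z ^+ 4 / a ^+ 3.
  by rewrite /a; field; rewrite gt_eqF// ltr_wpDl.
suff : z <= a + z ^+ 4 / a ^+ 3 by rewrite /a; lra.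
have z4 : 0 <= z ^+ 4 / a ^+ 3.
  by rewrite (divr_ge0 (exprn_even_ge0 z (isT : ~~ odd 4)))// exprn_ge0// ltW.
have [za|az] := leP z a; first by rewrite (le_trans za)// lerDl.
suff : z <= z ^+ 4 / a ^+ 3 by move: a0; lra.
rewrite ler_pdivlMr ?exprn_gt0// [z ^+ 4]exprS ler_pM2l ?(lt_trans a0)//.
have z0 := lt_trans a0 az.
by rewrite lerXn2r ?nnegrE ?(ltW a0) ?(ltW z0) ?(ltW az).
Qed.

(** The integral of a nonnegative function is a supremum over the simple functions below it, hence
    monotone. This form applies to the loss of an arbitrary, possibly nonmeasurable, selection
    [theta] of minimizers. *)
Lemma ge0_le_integralT (d : measure_display) (T : measurableType d)
    (R : realType) (m : {measure set T -> \bar R}) (f g : T -> \bar R) :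
  (forall x, 0 <= f x)%E -> (forall x, f x <= g x)%E ->
  (\int[m]_x f x <= \int[m]_x g x)%E.
Proof.
move=> f0 fg; have g0 x : (0 <= g x)%E by exact: le_trans (fg x).
rewrite !ge0_integralTE//; apply: ereal_sup_le => _ [h hf <-].
by exists h => // x; exact: le_trans (hf x) (fg x).
Qed.

(** * Chaining on one side of the oracle *)

Section one_sided_chaining.
Context (R : realType) (kappa : R) (kappa1 : 1 <= kappa).
Context (d : measure_display) (T : measurableType d) (P : probability T R).
Context (n p M : nat) (eps : 'I_n -> {RV P >-> R}) (sigma : R).
Hypotheses (sigma0 : 0 < sigma) (noise : gaussian_noise sigma eps).
Hypothesis moment_eps : forall i k, (k == 4%N) || (k == 8%N) ->
  \int[P]_x (eps i x ^+ k) <= kappa * sigma ^+ k.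
Context (X : 'M[R]_(n, p)) (K : 'M[R]_p) (K_pos : posdefmx K).
Context (lam : 'I_M -> R) (lam0 : forall j, 0 <= lam j).
Hypothesis S_pos : forall j, posdefmx (X^T *m X + lam j *: K).
Context (mu : 'cV[R]_n) (j0 : 'I_M).

Let z j t := chaos sigma (quad_coef X K (lam j0) (lam j))
  (lin_coef X K mu (lam j0) (lam j)) (\col_i eps i t).
Let F j := penalty X K sigma mu (lam j0) (lam j).

(** [r] lists indices whose parameters move away from [lam j0], so that [F] is nondecreasing along
    it. A single [V] serves all of [r], so its integral is bounded without reference to the number
    of candidates. *)
Lemma one_sided_chaining (r : seq 'I_M) :
  nth j0 r 0 = j0 ->
  (forall i j, (i <= j < size r)%N ->
    (lam j0 <= lam (nth j0 r i) <= lam (nth j0 r j)) ||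
    (lam (nth j0 r j) <= lam (nth j0 r i) <= lam j0)) ->
  exists V : T -> R, [/\ poly_below eps n V, forall t, 0 <= V t,
    forall j t, j \in r -> z j t ^+ 4 / (F j + sigma ^+ 2) ^+ 3 <= V t &
    \int[P]_t V t <= (256 * kappa ^+ 2 * 40) ^+ 2 * (2916 * 64 / 3) * sigma ^+ 2].
Proof.
move=> r0 r_ord; pose b := (size r).-1; pose l k := lam (nth j0 r k).
have in_range i j : (i <= j <= b)%N -> (0 < size r)%N -> (i <= j < size r)%N.
  by move=> /andP[-> jb] r_gt0; rewrite -(prednK r_gt0) ltnS.
(* The empty list also meets the hypotheses, through the default value of [nth]; for it [b = 0] is
   not a position. *)
have [/size0nil ->|r_gt0] := posnP (size r).
  exists (fun=> 0); split=> //; first exact: poly_cst.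
  rewrite Rint_cst; apply: mulr_ge0; last exact: sqr_ge0.
  by apply: mulr_ge0; [exact: sqr_ge0|lra].
pose Fr k := F (nth j0 r k).
have incr i j : (i <= j <= b)%N ->
    dotv (lin_coef X K mu (lam j0) (l j) - lin_coef X K mu (lam j0) (l i))
      (lin_coef X K mu (lam j0) (l j) - lin_coef X K mu (lam j0) (l i))
    + sigma ^+ 2 * frob2 (quad_coef X K (lam j0) (l j) - quad_coef X K (lam j0) (l i))
    <= 40 * (Fr j - Fr i).
  move=> ij; apply: (increment_le_penalty K_pos) => //; last first.
  - exact: r_ord (in_range _ _ ij r_gt0).
  - exact: (conj (lam0 _) (S_pos _)).
  - exact: (conj (lam0 _) (S_pos _)).
have Fnd i j : (i <= j <= b)%N -> Fr i <= Fr j.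
  move=> /incr ij; rewrite -subr_ge0 -(@pmulr_rge0 _ 40)//; apply: le_trans ij.
  by rewrite addr_ge0 ?dotv_ge0// mulr_ge0 ?sqr_ge0 ?frob2_ge0.
have Fr0 : Fr 0%N = 0 by rewrite /Fr r0 /F penalty_id.
have s2 : 0 < sigma ^+ 2 by rewrite exprn_gt0.
have [s [sP sz sF]] := chaining_peeled s2 Fr0 Fnd.
pose zr t k := z (nth j0 r k) t.
have pz k : poly_below eps n (fun t => zr t k) by exact: chaos_poly.
have pdz k m : poly_below eps n (fun t => (zr t k - zr t m) ^+ 4).
  have pd : poly_below eps n (fun t => zr t k - zr t m).
    by under eq_fun do rewrite -[- _]mulN1r; exact: poly_add (pz k) (poly_scale (-1) (pz m)).
  exact: (poly_exp 4 pd).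
have dz i j : (i <= j <= b)%N -> \int[P]_t ((zr t j - zr t i) ^+ 4)
    <= (256 * kappa ^+ 2 * 40 * sigma ^+ 2) ^+ 2 * (Fr j - Fr i) ^+ 2.
  move=> ij; under eq_Rintegral do rewrite chaosB.
  apply: le_trans (chaos_fourth_moment sigma0 noise kappa1 moment_eps _ _) _.
  rewrite -exprMn; have k0 : 0 <= 256 * kappa ^+ 2 * sigma ^+ 2.
    by apply: mulr_ge0; [apply: mulr_ge0; [lra|exact: sqr_ge0]|exact: sqr_ge0].
  have Q0 := addr_ge0
    (dotv_ge0 (lin_coef X K mu (lam j0) (l j) - lin_coef X K mu (lam j0) (l i)))
    (mulr_ge0 (sqr_ge0 sigma) (frob2_ge0
      (quad_coef X K (lam j0) (l j) - quad_coef X K (lam j0) (l i)))).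
  have -> : 256 * kappa ^+ 2 * 40 * sigma ^+ 2 * (Fr j - Fr i) =
    256 * kappa ^+ 2 * sigma ^+ 2 * (40 * (Fr j - Fr i)) by ring.
  have le := ler_wpM2l k0 (incr _ _ ij).
  have lhs0 := mulr_ge0 k0 Q0.
  exact: sqr_le_sqr lhs0 le.
have pS s' : poly_below eps n (fun t => incr_sum 4 s' (zr t)).
  rewrite /incr_sum; elim: s' => [|q s' IH].
    by under eq_fun do rewrite big_nil; exact: poly_cst.
  under eq_fun do rewrite big_cons.
  exact: poly_add (poly_scale q.1 (pdz q.2.2 q.2.1)) IH.
exists (fun t => incr_sum 4 s (zr t)); split.
- exact: pS.
- by move=> t; apply: incr_sum_ge0 sP.
- move=> j t jr.
  have zr0 : zr t 0%N = 0.
    rewrite /zr r0 /z /quad_coef /lin_coef subrr mul0mx !scaler0 subrr mul0mx.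
    by rewrite /chaos mul0mx !dotv0r mxtrace0 mulr0 subrr addr0.
  have jb : (index j r <= b)%N by rewrite -ltnS prednK// index_mem.
  by have := sz (zr t) _ zr0 jb; rewrite /zr /Fr nth_index.
- apply: (@le_trans _ _ ((256 * kappa ^+ 2 * 40 * sigma ^+ 2) ^+ 2 * incr_sum 2 s Fr)).
    move: sP; rewrite /incr_sum; elim: (s) => [|q s' IH] /=.
      by under eq_Rintegral do rewrite big_nil; rewrite Rint_cst big_nil mulr0.
    move=> /andP[/and3P[q0 q1 q2] /IH {}IH].
    have jq := poly_int sigma0 noise (poly_scale q.1 (pdz q.2.2 q.2.1)).
    have js := poly_int sigma0 noise (pS s').
    under eq_Rintegral do rewrite big_cons.
    rewrite (RintD jq js) big_cons mulrDr; apply: lerD IH.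
    rewrite (RintZ _ (poly_int sigma0 noise (pdz _ _))) mulrCA.
    by apply: (ler_wpM2l q0); apply: dz; rewrite q1.
  (* Peeling with [tau = sigma^2] turns the factor [sigma^4] of the increments into [sigma^2]. *)
  apply: (@le_trans _ _ ((256 * kappa ^+ 2 * 40 * sigma ^+ 2) ^+ 2 * (2916 * 64 / 3 / sigma ^+ 2))).
    by rewrite ler_wpM2l ?sqr_ge0.
  by rewrite le_eqVlt; apply/orP; left; apply/eqP; field; rewrite gt_eqF.
Qed.
End one_sided_chaining.

(** [W] depends on the noise but not on [theta]: the excess bound is linear in weights that sum to
    one, so it is enough to dominate each vertex. The constant is [1/2] from the offset plus [8] for
    each of the two sides. *)
Lemma tikhonov_excess_le (R : realType) (kappa : R) : 1 <= kappa ->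
  forall (d : measure_display) (T : measurableType d) (P : probability T R)
    (n p M : nat) (eps : 'I_n -> {RV P >-> R}) (sigma : R),
  0 < sigma -> gaussian_noise sigma eps ->
  (forall i k, (k == 4%N) || (k == 8%N) ->
    \int[P]_x (eps i x ^+ k) <= kappa * sigma ^+ k) ->
  forall (X : 'M[R]_(n, p)) (K : 'M[R]_p), posdefmx K ->
  forall lam : 'I_M -> R, (forall j, 0 <= lam j) ->
    (forall j, posdefmx (X^T *m X + lam j *: K)) ->
  forall (mu : 'cV[R]_n) (j0 : 'I_M),
  exists W : T -> R, [/\ poly_below eps n W, forall t, 0 <= W t,
    forall t (theta : 'cV[R]_M), let y := mu + \col_i eps i t in
      is_argmin (@simplex R M) (Q_obj X K lam sigma y) theta ->
      l2norm (X *m aggregate X K lam y theta - mu) ^+ 2 <=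
      l2norm (X *m tikhonov X K (lam j0) y - mu) ^+ 2 + W t &
    \int[P]_t W t <=
      (2^-1 + 16 * ((256 * kappa ^+ 2 * 40) ^+ 2 * (2916 * 64 / 3))) * sigma ^+ 2].
Proof.
move=> kappa1 d T P n p M eps sigma sigma0 noise moment X K K_pos lam lam0 S_pos mu j0.
have s2 : 0 < sigma ^+ 2 by rewrite exprn_gt0.
set c := (_ * 40) ^+ 2 * _.
pose up := relpre lam <=%R; pose down := relpre lam >=%R.
have up_total : total up by move=> i j; exact: le_total.
have down_total : total down by move=> i j; exact: le_total.
have up_trans : transitive up by move=> i j k; exact: le_trans.
have down_trans : transitive down by move=> i j k ji ik; exact: le_trans ik ji.
(* The oracle is put in front to start the chain. It occurs again in the filtered list, harmlessly,
   since only weak monotonicity along the list is required. *)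
pose ru := j0 :: sort up [seq j <- enum 'I_M | lam j0 <= lam j].
pose rd := j0 :: sort down [seq j <- enum 'I_M | lam j <= lam j0].
have su : sorted up ru.
  rewrite /= path_sortedE// sort_sorted// andbT; apply/allP => j.
  by rewrite mem_sort mem_filter => /andP[].
have sd : sorted down rd.
  rewrite /= path_sortedE// sort_sorted// andbT; apply/allP => j.
  by rewrite mem_sort mem_filter => /andP[].
have up_refl : reflexive up by move=> i; exact: lexx.
have down_refl : reflexive down by move=> i; exact: lexx.
have chain r := @one_sided_chaining R kappa kappa1 d T P n p M eps
  sigma sigma0 noise moment X K K_pos lam lam0 S_pos mu j0 r.
have [i j /andP[ij jr]|Vu [pu u0 uz iu]] := chain ru erefl.
  have ir := leq_ltn_trans ij jr.
  have h1 : up j0 (nth j0 ru i) by exact: (sorted_leq_nth up_trans up_refl j0 su 0%N i).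
  have h2 : up (nth j0 ru i) (nth j0 ru j).
    exact: (sorted_leq_nth up_trans up_refl j0 su i j ir jr ij).
  by apply/orP; left; apply/andP.
have [i j /andP[ij jr]|Vd [pd d0 dz id]] := chain rd erefl.
  have ir := leq_ltn_trans ij jr.
  have h1 : down j0 (nth j0 rd i) by exact: (sorted_leq_nth down_trans down_refl j0 sd 0%N i).
  have h2 : down (nth j0 rd i) (nth j0 rd j).
    exact: (sorted_leq_nth down_trans down_refl j0 sd i j ir jr ij).
  by apply/orP; right; apply/andP.
have s20 : 0 <= 2^-1 * sigma ^+ 2 by rewrite mulr_ge0 ?sqr_ge0 ?invr_ge0.
have pW := poly_add (poly_cst _ n (2^-1 * sigma ^+ 2)) (poly_scale 8 (poly_add pu pd)).
exists (fun t => 2^-1 * sigma ^+ 2 + 8 * (Vu t + Vd t)); split.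
- exact: pW.
- by move=> t; rewrite addr_ge0// mulr_ge0// addr_ge0.
- move=> t theta y theta_min.
  have [[theta0 theta1] _] := theta_min.
  have := @Q_argmin_excess R n p M X K lam sigma mu y theta j0 _ (fun=> erefl) theta_min.
  move/le_trans; apply; rewrite lerD2l.
  set w := 2^-1 * _ + _.
  have -> : w = \sum_j theta j 0 * w by rewrite -mulr_suml theta1 mul1r.
  apply: ler_sum => j _; apply: ler_wpM2l => //.
  rewrite !mulmx_tikhonov -mulmxBl.
  have -> : tikhonov_df X K (lam j) - tikhonov_df X K (lam j0) =
    \tr (smoother X K (lam j) - smoother X K (lam j0)) by rewrite linearB.
  have -> : y - mu = \col_i eps i t by rewrite /y addrC addKr.
  rewrite excess_chaosE//.
  have F0 : 0 <= penalty X K sigma mu (lam j0) (lam j).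
    by rewrite addr_ge0 ?dotv_ge0// mulr_ge0 ?sqr_ge0 ?frob2_ge0.
  apply: (le_trans (chaos_excess_le _ F0 s2)); rewrite lerD2l ler_pM2l//.
  have [jj0|/ltW jj0] := leP (lam j0) (lam j).
    apply: (le_trans (uz j t _)); last by rewrite lerDl.
    by rewrite in_cons mem_sort mem_filter jj0 mem_enum orbT.
  apply: (le_trans (dz j t _)); last by rewrite lerDr.
  by rewrite in_cons mem_sort mem_filter jj0 mem_enum orbT.
- have ju := poly_int sigma0 noise pu; have jd := poly_int sigma0 noise pd.
  have jud := integrableRD ju jd; have j8 := integrableRZ 8 jud.
  have jc := @integrableR_cst _ _ _ P (2^-1 * sigma ^+ 2).
  have -> : \int[P]_t (2^-1 * sigma ^+ 2 + 8 * (Vu t + Vd t)) =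
      2^-1 * sigma ^+ 2 + 8 * (\int[P]_t Vu t + \int[P]_t Vd t).
    by rewrite (RintD jc j8) Rint_cst (RintZ _ jud) (RintD ju jd).
  move: iu id; rewrite -/c; move: c (sigma ^+ 2) (\int[P]_t _) (\int[P]_t _).
  by move=> u v a b; lra.
Qed.

Theorem corollary3p2 (R : realType) :
  exists2 C1 : R, 0 < C1 &
  forall (n p M : nat), (1 <= n)%N -> (1 <= p)%N -> (1 <= M)%N ->
  forall (sigma : R), 0 < sigma ->
  forall (mu : 'cV[R]_n)
    (d : measure_display) (T : measurableType d) (P : probability T R)
    (eps : 'I_n -> {RV P >-> R}), gaussian_noise sigma eps ->
  forall (X : 'M[R]_(n, p)) (K : 'M[R]_p), posdefmx K ->
  forall (lam : 'I_M -> R), (forall j, 0 <= lam j) -> injective lam ->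
    ((exists j, lam j = 0) -> X^T *m X \in unitmx) ->
  let y (t : T) : 'cV[R]_n := mu + \col_(i < n) eps i t in
  forall (theta : T -> 'cV[R]_M),
    (forall t, is_argmin (@simplex R M) (Q_obj X K lam sigma (y t)) (theta t)) ->
  let wtilde (t : T) : 'cV[R]_p := aggregate X K lam (y t) (theta t) in
  ('E_P[fun t => (l2norm (X *m wtilde t - mu) ^+ 2)%R]
   - \big[mine/+oo]_(j < M)
       'E_P[fun t => (l2norm (X *m tikhonov X K (lam j) (y t) - mu) ^+ 2)%R]
   <= (C1 * sigma ^+ 2)%:E)%E.
Proof.
have [kappa kappa1 moment] := gaussian_moment_48 R.
(* Only [kappa] enters, and it was obtained before dimensions, noise level and design are
   introduced. *)
set c := 2^-1 + 16 * ((256 * kappa ^+ 2 * 40) ^+ 2 * (2916 * 64 / 3)).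
exists c.
  by rewrite /c; move: (sqr_ge0 (256 * kappa ^+ 2 * 40)); move: (_ ^+ 2) => u u0; lra.
move=> n p M _ _ M_gt0 sigma sigma0 mu d T P eps noise X K K_pos lam lam0 _ lam_unit
  y theta theta_min; lazy zeta.
have S_pos j : posdefmx (X^T *m X + lam j *: K).
  by apply: tikhonov_posdef => // lj0; apply: lam_unit; exists j.
pose f j t := l2norm (X *m tikhonov X K (lam j) (y t) - mu) ^+ 2.
have [j0 _ ->] := @eq_bigmin _ _ _ (+oo%E : \bar R) (Ordinal M_gt0) predT
  (fun j => 'E_P[f j])%E isT (fun j _ => leey _).
(* The oracle loss is a polynomial in the noise, so its expectation is finite and can be moved
   across the extended-real inequality. *)
have pf : poly_below eps n (f j0).
  have -> : f j0 = fun t => \sum_i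
      (\sum_k smoother X K (lam j0) i k * (mu k 0 + eps k t) + - mu i 0) ^+ 2.
    apply/funext => t; rewrite /f l2norm_sqr -/(dotv _ _) dotvE mulmx_tikhonov.
    apply: eq_bigr => i _; rewrite -expr2 !mxE; congr ((_ + _) ^+ 2).
    by apply: eq_bigr => k _; rewrite !mxE.
  apply: poly_sum => i _; apply: poly_exp; apply: poly_add; last exact: poly_cst.
  apply: poly_sum => k _; apply: poly_scale; apply: poly_add; first exact: poly_cst.
  exact: poly_eps.
have momentP i k : (k == 4%N) || (k == 8%N) ->
    \int[P]_x (eps i x ^+ k) <= kappa * sigma ^+ k.
  exact: moment (noise.2 i) k.
have [W [pW W0 WP WE]] := tikhonov_excess_le kappa1 sigma0 noise momentP K_pos
  lam0 S_pos mu j0.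
have jf := poly_int sigma0 noise pf; have jW := poly_int sigma0 noise pW.
have Ej0 : ('E_P[f j0] = (\int[P]_t f j0 t)%R%:E)%E.
  by rewrite unlock fineK//; exact: integrable_fin_num jf.
have f0 t : 0 <= f j0 t by rewrite sqr_ge0.
(* Only the majorant needs to be integrable here; the loss of the aggregate is compared with it
   pointwise. *)
have excess : ('E_P[fun t => (l2norm (X *m aggregate X K lam (y t) (theta t) - mu) ^+ 2)%R] <=
    (\int[P]_t f j0 t + \int[P]_t W t)%R%:E)%E.
  rewrite -RintD// unlock fineK; last exact: integrable_fin_num (integrableRD jf jW).
  apply: ge0_le_integralT => t; first by rewrite lee_fin sqr_ge0.
  by rewrite lee_fin; exact: WP (theta_min t).
rewrite Ej0 leeBlDr//; apply: (le_trans excess).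
by rewrite -EFinD lee_fin addrC lerD2r.
Qed.
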